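(* Let a regular pencil be spanned by quadratic forms $Q_1,Q_2$ on a $(2n+1)$-dimensional $k$-vector space $U$ with $Q_1$ non-degenerate and associated self-adjoint operator $T$, and let $f(x)=\prod_{i=1}^{r+1}(x-\alpha_i)^{m_i}$ over $k^s$ with the $\alpha_i$ distinct. For any integers $d_1,\ldots,d_{r+1}$ with $0\le d_i\le m_i/2$, $$\bigl|L^T_{\{d_1,\ldots,d_{r+1}\}}(k^s)\bigr|=2^r/2^a,$$ where $a$ is the number of indices $i$ with $d_i=m_i/2$.
   Context: $k$ is a field of characteristic not $2$, $k^s$ a separable closure, $n\ge1$, $U$ a $k$-vector space of dimension $2n+1$, $Q_1,Q_2$ quadratic forms on $U$ over $k$ with associated bilinear forms $b_1,b_2$ and Gram matrices $A_1,A_2$, and $Q_1$ is non-degenerate. $T:U\to U$ is the unique linear operator with $b_2(v,w)=b_1(v,Tw)$ for all $v,w\in U$; it is self-adjoint for $b_1$. Put $f(x)=(-1)^n\det(xA_1-A_2)$, normalised (after scaling the forms) to be monic, so that $f$ is the characteristic polynomial of $T$; $f$ is assumed to split completely over $k^s$. The pencil spanned by $Q_1,Q_2$ is regular if all its singular members are simple cones; equivalently, $T$ is regular, i.e. all its eigenspaces (over an algebraic closure) are 1-dimensional. $U_{i,T}\subset U\otimes k^s$ denotes the generalized eigenspace of $T$ with eigenvalue $\alpha_i$ (of dimension $m_i$). The symbol $\perp$ refers to $Q_1$. For a linear subspace $X\subset U\otimes k^s$, $\dim_{i,T}(X)$ is the dimension of the maximal $T$-stable subspace of $X\cap U_{i,T}$.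 Define $$L^T_{\{d_1,\ldots,d_{r+1}\}}(k^s)=\{X\subset U\otimes k^s \mid \dim X=n,\ X\subset X^\perp,\ TX\subset X^\perp,\ \dim_{i,T}(X)=d_i\text{ for all }i\}.$$ *)

(* Defs.v *)
From HB Require Import structures.
From mathcomp Require Import all_boot all_algebra all_field.
From mathcomp Require Import boolp classical_sets functions cardinality.

Set Implicit Arguments.
Unset Strict Implicit.
Unset Printing Implicit Defensive.

Import GRing.Theory.
Local Open Scope ring_scope.

Section Closures.

Definition separable_closure (k ks : fieldType) (iota : {rmorphism k -> ks}) :=
  (forall x : ks,
     exists2 p : {poly k}, separable_poly p & root (map_poly iota p) x) /\
  (forall p : {poly ks},
     separable_poly p -> (1 < size p)%N -> exists x, root p x).

Definition algebraic_closure (k : fieldType) (kbar : closedFieldType)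
    (j : {rmorphism k -> kbar}) :=
  forall x : kbar, algebraicOver j x.

End Closures.

Section QuadraticForms.
Variables (k : fieldType) (U : vectType k).
Implicit Types (Q : U -> k) (b : U -> U -> k).

Definition polar Q (v w : U) : k := Q (v + w) - Q v - Q w.

(* [polar Q] is symmetric, so linearity in the second argument suffices. *)
Definition quadratic_form Q :=
  (forall (c : k) (v : U), Q (c *: v) = c ^+ 2 * Q v) /\
  (forall (c : k) (u v w : U),
     polar Q u (c *: v + w) = c * polar Q u v + polar Q u w).

Definition nondegenerate_form b :=
  forall v : U, (forall w : U, b v w = 0) -> v = 0.

Definition gram N (e : N.-tuple U) b : 'M[k]_N :=
  \matrix_(i, j) b e`_i e`_j.

End QuadraticForms.

Section Pencils.
Variables (F : fieldType) (N : nat).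
Implicit Types A B : 'M[F]_N.

(* The quadric with Gram matrix [A] is a cone whose vertex is the
   projectivisation of the radical of [A]; it is a simple cone when this vertex
   is a single point. *)
Definition simple_cone A := \rank (kermx A) = 1%N.

Definition regular_pencil A B :=
  forall s t : F, (s, t) != (0, 0) ->
    \det (s *: A + t *: B) = 0 -> simple_cone (s *: A + t *: B).

Definition pencil_poly (n : nat) A B : {poly F} :=
  (-1) ^+ n *: \det ('X *: map_mx polyC A - map_mx polyC B).

End Pencils.

(* Given a basis [e] of [U], the space [U] (x) [ks] is ['rV[ks]_N]: the row
   vector [x] stands for the sum of the [e_i (x) x_i]. *)
Section ScalarExtension.
Variables (k ks : fieldType) (iota : {rmorphism k -> ks}).
Variables (U : vectType k) (N : nat) (e : N.-tuple U).

Definition ext_vec (u : U) : 'rV[ks]_N := \row_i iota (coord e i u).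

Definition ext_end (T : 'End(U)) : 'End('rV[ks]_N) :=
  linfun (mulmxr (\matrix_(i, j) iota (coord e j (T e`_i)))).

Definition ext_form (b : U -> U -> k) (x y : 'rV[ks]_N) : ks :=
  (x *m map_mx iota (gram e b) *m y^T) 0 0.

Hypothesis e_basis : basis_of fullv e.

Lemma ext_end_vec (T : 'End(U)) (u : U) :
  ext_end T (ext_vec u) = ext_vec (T u).
Proof.
rewrite lfunE; apply/rowP => j; rewrite !mxE.
rewrite [in RHS](coord_basis e_basis (memvf u)) !linear_sum rmorph_sum /=.
by apply: eq_bigr => i _; rewrite !mxE !linearZ rmorphM.
Qed.

Lemma ext_form_polar (Q : U -> k) (u v : U) : quadratic_form Q ->
  ext_form (polar Q) (ext_vec u) (ext_vec v) = iota (polar Q u v).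
Proof.
move=> [_ Qlin].
have Qsym x y : polar Q x y = polar Q y x.
  by rewrite /polar (addrC x) -!addrA (addrC (- Q x)).
have Q0 x : polar Q x 0 = 0.
  have := Qlin 1 x 0 0; rewrite scaler0 addr0 mul1r.
  by move/(congr1 (fun z => z - polar Q x 0)); rewrite addrK subrr.
have Qsum x (c : 'I_N -> k) :
    polar Q x (\sum_i c i *: e`_i) = \sum_i c i * polar Q x e`_i.
  by elim/big_rec2: _ => [|i y1 y2 _ IH]; rewrite ?Q0 // Qlin IH.
rewrite /ext_form mxE [in RHS](coord_basis e_basis (memvf v)) Qsum rmorph_sum.
apply: eq_bigr => j _; rewrite !mxE rmorphM mulrC; congr (_ * _).
rewrite [in RHS](coord_basis e_basis (memvf u)) Qsym Qsum rmorph_sum.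
by apply: eq_bigr => i _; rewrite !mxE Qsym rmorphM.
Qed.

End ScalarExtension.

Section LinearSubspaces.
Variables (F : fieldType) (V : vectType F).
Implicit Types (T : 'End(V)) (b : V -> V -> F) (X Y W : {vspace V}).

Definition gen_eigenspace T (c : F) : {vspace V} :=
  lker (iter (\dim {:V}) (fun g : 'End(V) => (T - c *: \1) \o g)%VF \1%VF).

Definition stable T W := (T @: W <= W)%VS.

Definition maximal_stable T Y W :=
  [/\ (W <= Y)%VS, stable T W
    & forall W', (W' <= Y)%VS -> stable T W' -> (W' <= W)%VS].

(* The dimension of the maximal [T]-stable subspace of [Y] is [d]. *)
Definition dim_stable T Y (d : nat) :=
  exists2 W, maximal_stable T Y W & \dim W = d.

Definition perp b X (v : V) := forall w, w \in X -> b v w = 0.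

Definition LT (n r : nat) b T (alpha : 'I_r.+1 -> F) (d : 'I_r.+1 -> nat) :
    set {vspace V} :=
  [set X | [/\ \dim X = n,
               forall v, v \in X -> perp b X v,
               forall v, v \in X -> perp b X (T v)
             & forall i, dim_stable T (X :&: gen_eigenspace T (alpha i)) (d i)]
  ]%classic.

End LinearSubspaces.

(* Main.v *)
Require Import Defs.
From HB Require Import structures.
From mathcomp Require Import all_boot all_algebra all_field.
From mathcomp Require Import boolp classical_sets functions cardinality.
From mathcomp Require Import ring zify.

(** Write [K] for the separably closed field, [f] for the product of the
    [(x - alpha i) ^ (m i)] and [b], [T] for the form and the operator extended
    to [K].

    Regularity says that the eigenspaces of [T] are lines, so [T] has a cyclic
    vector ([cyclic_vector]) and the whole space is [K[x]/(f)] with [T] acting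
    as multiplication by [x].  Since [T] is self-adjoint, [b p q = lam (p q)]
    for one linear functional [lam], and the pairing is non-degenerate modulo
    [f].  From there on everything is arithmetic of polynomials.

    Let [h] be the product of the [(x - alpha i) ^ (d i)] and [F] that of the
    [(x - alpha i) ^ (m i - 2 d i)].  Then [f = h^2 F], and [F] has degree
    [2k + 1] with [k = n - deg h].  A stable subspace is an ideal, and the
    conditions on the [d i] mean together that [(h F)] is the largest ideal
    contained in [X] ([dim_stable_largest_ideal]); as [X] is isotropic, it
    lies between [(h F)] and its orthogonal [(h)].

    The orthogonal of [X] contains [T X] and has dimension [dim X + 1], so each
    of the requirements [T^l v in X], [l = 1, 2, ...], lowers the dimension of
    the space of admissible [v] by at most one ([shift_chain]).  This leaves
    some [v = h p] outside [(h F)] with [v, T v, ..., T^(k-1) v] in [X], and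
    then [X] is the sum of [(h F)] and of the span of these vectors.  Isotropy
    of [X] and [T X] reads [lam (h^2 p^2 x^l) = 0] for all [l < 2k].  There is
    a unit [mu] modulo [F] such that [lam (h^2 mu q)] is the coefficient of
    [x^(2k)] in [q mod F] ([coefficient_unit]); so [p^2] is a multiple of [mu]
    modulo [F], a non-zero one because otherwise [X] would contain a larger
    ideal.  As [K] contains square roots, [p] can be scaled to
    [p^2 = mu mod F], which determines it up to sign.  Conversely each square
    root gives a subspace of the required kind ([root_space_isotropic],
    [isotropic_root_space], [root_space_inj]).

    By Hensel lifting and the Chinese remainder theorem, a square root of [mu]
    modulo [F] is one choice of sign at each of the [r + 1 - a] roots of [F]
    ([sqrt_mod_signs]).  Identifying [p] with [- p] halves their number, which
    leaves [2 ^ (r - a)] subspaces. *)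

Set Implicit Arguments.
Unset Strict Implicit.
Unset Printing Implicit Defensive.

Import GRing.Theory.
Local Open Scope ring_scope.

(** * Polynomials with prescribed roots and square roots modulo them *)

Section PolynomialArithmetic.
Variables (K : fieldType) (I : finType).

Lemma coprimep_prodr (J : Type) (s : seq J) (C : pred J) (P : J -> {poly K})
    (p : {poly K}) :
  (forall i, C i -> coprimep p (P i)) ->
  coprimep p (\prod_(i <- s | C i) P i).
Proof.
move=> cop; elim/big_rec: _ => [|i x Ci cx]; first exact: coprimep1.
by rewrite coprimepMr cop.
Qed.

Lemma dvdp_prod_coprime (P : I -> {poly K}) (p : {poly K}) :
  (forall i j, i != j -> coprimep (P i) (P j)) ->
  (forall i, P i %| p) -> \prod_i P i %| p.
Proof.
move=> cop dv; have: uniq (index_enum I) by exact: index_enum_uniq.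
elim: (index_enum I) => [|i s IHs] /=; first by rewrite big_nil dvd1p.
case/andP=> nis us; rewrite big_cons Gauss_dvdp ?dv ?IHs //.
rewrite big_seq; apply: coprimep_prodr => j js; apply: cop.
by apply: contraNneq nis => ->.
Qed.

(** The idempotents of the Chinese remainder theorem, lifted to polynomials;
    they split the cyclic module into its primary parts and glue local square
    roots. *)
Lemma crt_idempotents (P : I -> {poly K}) :
  (forall i j, i != j -> coprimep (P i) (P j)) ->
  exists E : I -> {poly K}, forall i j, P j %| E i - (i == j)%:R.
Proof.
move=> cop.
have ex i : exists E : {poly K}, [forall j, P j %| E - (i == j)%:R].
  have /Bezout_eq1_coprimepP [[u v] /= uv] :
      coprimep (P i) (\prod_(j | j != i) P j).
    by apply: coprimep_prodr => j; rewrite eq_sym; apply: cop.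
  exists (v * \prod_(j | j != i) P j); apply/forallP => j.
  case: (eqVneq i j) => [<-|ij].
    by rewrite -[true%:R]uv opprD addrCA subrr addr0 -mulNr dvdp_mull.
  by rewrite subr0 (bigD1 j) 1?eq_sym //= mulrCA dvdp_mulr.
exists (fun i => xchoose (ex i)) => i j.
by move/forallP: (xchooseP (ex i)).
Qed.

Lemma dvdp_opp (p q : {poly K}) : (p %| - q) = (p %| q).
Proof. by rewrite -scaleN1r dvdpZr // oppr_eq0 oner_eq0. Qed.

Lemma dvdp_sum (J : Type) (s : seq J) (C : pred J) (P : J -> {poly K})
    (p : {poly K}) :
  (forall i, C i -> p %| P i) -> p %| \sum_(i <- s | C i) P i.
Proof. by move=> dv; elim/big_rec: _ => [|i x Ci dx]; rewrite ?dvdp0 ?dvdp_add ?dv. Qed.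

Lemma poly_sum_coef (c : {poly K}) (s : nat) :
  (size c <= s)%N -> c = \sum_(i < s) c`_i *: 'X^i.
Proof.
move=> sc; rewrite -poly_def; apply/polyP => i; rewrite coef_poly.
by case: ltnP => // si; rewrite nth_default // (leq_trans sc).
Qed.

Section Roots.
Variable a : I -> K.
Hypothesis a_inj : injective a.

Definition split_poly (c : I -> nat) : {poly K} :=
  \prod_i ('X - (a i)%:P) ^+ c i.

Lemma coprimep_XsubC_exp (c c' : nat) i j : i != j ->
  coprimep (('X - (a i)%:P) ^+ c) (('X - (a j)%:P) ^+ c').
Proof.
move=> ij; apply/coprimep_expl/coprimep_expr/coprimep_XsubC2.
by rewrite subr_eq0 (inj_eq a_inj) eq_sym.
Qed.

Lemma split_polyD1 (c : I -> nat) i :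
  split_poly c =
    (\prod_(j | j != i) ('X - (a j)%:P) ^+ c j) * ('X - (a i)%:P) ^+ c i.
Proof. by rewrite /split_poly (bigD1 i) //= mulrC. Qed.

Lemma coprimep_cofactor (c : I -> nat) c' i :
  coprimep (('X - (a i)%:P) ^+ c') (\prod_(j | j != i) ('X - (a j)%:P) ^+ c j).
Proof.
by apply: coprimep_prodr => j ji; apply: coprimep_XsubC_exp; rewrite eq_sym.
Qed.

Lemma split_poly_monic c : split_poly c \is monic.
Proof. by apply: monic_prod => i _; rewrite monic_exp ?monicXsubC. Qed.

Lemma split_poly_neq0 c : split_poly c != 0.
Proof. exact/monic_neq0/split_poly_monic. Qed.

Lemma size_split_poly c : size (split_poly c) = (\sum_i c i)%N.+1.
Proof.
rewrite /split_poly; elim/big_rec2: _ => [|i x y _ IH]; first by rewrite size_poly1.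
have nz : (y == 0) = false by apply/negP => /eqP y0; rewrite y0 size_poly0 in IH.
rewrite size_monicM ?monic_exp ?monicXsubC ?nz //.
by rewrite size_exp_XsubC IH addSn addnS.
Qed.

Lemma split_polyD c1 c2 :
  split_poly c1 * split_poly c2 = split_poly (fun i => c1 i + c2 i)%N.
Proof. by rewrite -big_split; apply: eq_bigr => i _; rewrite /= exprD. Qed.

Lemma dvdp_split_poly c p :
  reflect (forall i, ('X - (a i)%:P) ^+ c i %| p) (split_poly c %| p).
Proof.
apply: (iffP idP) => [dv i|].
  by apply: dvdp_trans dv; rewrite (split_polyD1 c i) dvdp_mulIr.
by apply: dvdp_prod_coprime => i j; apply: coprimep_XsubC_exp.
Qed.

End Roots.

Section SquareRoots.
Hypothesis two_neq0 : (2%:R : K) != 0.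
Hypothesis sqrt_closed : forall x : K, exists y, y ^+ 2 = x.

(** Hensel lifting: a square root modulo [('X - x) ^ m] is corrected by a
    multiple of [('X - x) ^ m], and the linear equation for the correction is
    solvable because twice the root is invertible at [x]. *)
Lemma sqrt_XsubC_exp (mu : {poly K}) (x : K) (m : nat) : mu.[x] != 0 ->
  exists s : {poly K}, (s.[x] != 0) && (('X - x%:P) ^+ m %| s ^+ 2 - mu).
Proof.
move=> mux; elim: m => [|m [s /andP[sx /dvdpP[t Et]]]].
  by exists 1; rewrite hornerC oner_neq0 dvd1p.
case: m => [|m] in t Et *.
  have [y Ey] := sqrt_closed mu.[x].
  exists y%:P; rewrite hornerC expr1 dvdp_XsubCl; apply/andP; split.
    by apply: contraNneq mux => y0; rewrite -Ey y0 expr0n.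
  by rewrite /root !hornerE -Ey expr2 subrr.
pose w := t.[x] / (2%:R * s.[x]).
exists (s - w *: ('X - x%:P) ^+ m.+1); apply/andP; split.
  by rewrite !hornerE subrr expr0n mulr0 subr0.
have -> : (s - w *: ('X - x%:P) ^+ m.+1) ^+ 2 - mu =
    ('X - x%:P) ^+ m.+1 * (t - (2%:R * w) *: s)
    + (w ^+ 2) *: ('X - x%:P) ^+ (m.+1 + m.+1).
  have -> : mu = s ^+ 2 - t * ('X - x%:P) ^+ m.+1 by rewrite -Et subKr.
  by rewrite exprD -!mul_polyC !polyCM polyC_natr; ring.
rewrite dvdp_add //; last first.
  by rewrite -mul_polyC dvdp_mull ?dvdp_exp2l // addSn ltnS leq_addl.
rewrite exprSr dvdp_mul // dvdp_XsubCl /root !(hornerD, hornerN, hornerZ) /w.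
apply/eqP; by field; rewrite sx.
Qed.


(** In the local ring at [x] the factors [p - s] and [p + s] are not both
    non-units, since their difference is a unit; so one of them carries the
    whole power. *)
Lemma sqrt_mod_coprime (x : K) (m : nat) (s p : {poly K}) : s.[x] != 0 ->
  ('X - x%:P) ^+ m %| p ^+ 2 - s ^+ 2 ->
  ('X - x%:P) ^+ m %| p - s \/ ('X - x%:P) ^+ m %| p + s.
Proof.
move=> sx; have [->|m0] := posnP m; first by left; rewrite dvd1p.
rewrite subr_sqr => dv.
have [rt|rt] := boolP (root (p - s) x); last first.
  right; rewrite -(Gauss_dvdpr _ (_ : coprimep _ (p - s))) //.
  by rewrite coprimep_pexpl // coprimep_sym coprimep_XsubC.
left; rewrite -(Gauss_dvdpl _ (_ : coprimep _ (p + s))) //.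
rewrite coprimep_pexpl // coprimep_sym coprimep_XsubC.
move: rt; rewrite /root !hornerD hornerN subr_eq0 => /eqP ->.
by rewrite -mulr2n -mulr_natl mulf_neq0.
Qed.

(** A square root of [mu] modulo [split_poly a c] is a choice of sign at each
    root of positive multiplicity; the set [A] collects the negative signs.
    Up to a global sign the one at [i0] can be taken positive, which leaves
    the subsets of [J]. *)
Lemma sqrt_mod_signs (a : I -> K) (c : I -> nat) (mu : {poly K}) (i0 : I) :
    injective a -> (forall i, (0 < c i)%N -> mu.[a i] != 0) -> (0 < c i0)%N ->
  let F := split_poly a c in
  let J := [set i | (0 < c i)%N] :\ i0 in
  exists R : {set I} -> {poly K},
  [/\ forall A, F %| R A ^+ 2 - mu,
      forall p, F %| p ^+ 2 - mu ->
        exists2 A : {set I}, A \subset J & F %| p - R A \/ F %| p + R A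
    & forall A B : {set I}, A \subset J -> B \subset J ->
        F %| R A - R B \/ F %| R A + R B -> A = B].
Proof.
move=> a_inj mu0 ci0 F J.
pose P i := ('X - (a i)%:P) ^+ c i.
have copP i j : i != j -> coprimep (P i) (P j) by exact: coprimep_XsubC_exp.
have [E EP] := crt_idempotents copP.
have exs i : exists s : {poly K},
    ((0 < c i)%N ==> (s.[a i] != 0)) && (P i %| s ^+ 2 - mu).
  have [ci|ci] := posnP (c i); first by exists 0; rewrite /P ci dvd1p.
  exact: sqrt_XsubC_exp (mu0 i ci).
pose s i := xchoose (exs i).
have s0 i : (0 < c i)%N -> (s i).[a i] != 0.
  by move=> ci; case/andP: (xchooseP (exs i)) => /implyP/(_ ci).
have smu i : P i %| s i ^+ 2 - mu by case/andP: (xchooseP (exs i)).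
pose sg (A : {set I}) i : {poly K} := (-1) ^+ (i \in A) * s i.
pose R A := \sum_i E i * sg A i.
have RP A i : P i %| R A - sg A i.
  rewrite /R (bigD1 i) //= addrAC; apply: dvdp_add.
    by rewrite -{2}[sg A i]mul1r -mulrBl dvdp_mulr //; have := EP i i; rewrite eqxx.
  apply: dvdp_sum => j ji; rewrite dvdp_mulr //.
  by have := EP j i; rewrite (negPf ji) subr0.
have sgsq A i : sg A i ^+ 2 = s i ^+ 2 by rewrite /sg exprMn sqrr_sign mul1r.
have dvF p : (forall i, P i %| p) -> F %| p.
  by move=> dv; apply/dvdp_split_poly.
have Fdv p i : F %| p -> P i %| p by move/dvdp_split_poly; apply.
exists R; split.
- move=> A; apply: dvF => i.
  have -> : R A ^+ 2 - mu = (R A - sg A i) * (R A + sg A i) + (s i ^+ 2 - mu).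
    by rewrite -subr_sqr sgsq addrA subrK.
  by rewrite dvdp_add // dvdp_mulr.
- move=> p dvp.
  have dvps i : P i %| p - s i \/ P i %| p + s i.
    have [ci|ci] := posnP (c i); first by left; rewrite /P ci dvd1p.
    apply: (@sqrt_mod_coprime (a i) (c i)); first exact: s0.
    have -> : p ^+ 2 - s i ^+ 2 = (p ^+ 2 - mu) - (s i ^+ 2 - mu).
      by rewrite opprB addrA subrK.
    exact: dvdp_sub (Fdv _ _ dvp) (smu i).
  pose A := [set i | (0 < c i)%N && ~~ (P i %| p - s i)].
  have pA i : P i %| p - sg A i.
    rewrite /sg inE; have [c0|ci] := posnP (c i).
      by rewrite /P c0 expr0 dvd1p.
    have [dv|ndv] := boolP (P i %| p - s i); first by rewrite expr0 mul1r.
    rewrite expr1 mulN1r opprK; case: (dvps i) => // dv.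
    by rewrite dv in ndv.
  have [i0A|i0A] := boolP (i0 \in A).
    pose B := [set i | (0 < c i)%N] :\: A.
    exists B.
      apply/fintype.subsetP => i; rewrite !inE => /andP[iA ->]; rewrite andbT.
      by apply: contraTneq i0A => <-; rewrite inE.
    right; apply: dvF => i.
    have [c0|ci] := posnP (c i); first by rewrite /P c0 expr0 dvd1p.
    have -> : p + R B = (p - sg A i) + (R B - sg B i).
      have -> : sg B i = - sg A i.
        rewrite /sg !finset.in_setD [i \in finset _]inE ci andbT.
        by case: (i \in A); rewrite !(expr0, expr1) ?mulN1r ?mul1r ?opprK.
      by rewrite opprK addrA addrAC subrK.
    by rewrite dvdp_add.
  exists A.
    apply/fintype.subsetP => i iA; rewrite !inE; move: (iA); rewrite inE => /andP[-> _].
    by rewrite andbT; apply: contraNneq i0A => <-.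
  left; apply: dvF => i.
  have -> : p - R A = (p - sg A i) - (R A - sg A i).
    by rewrite opprB addrA subrK.
  by rewrite dvdp_sub.
move=> A B sA sB dv.
(* Two opposite signs at a root of positive multiplicity are incongruent,
   since 2 and the value of [s i] are invertible there. *)
have sep i (p q : {poly K}) : (0 < c i)%N -> P i %| p - s i -> P i %| q + s i ->
    P i %| p - q -> False.
  move=> ci dp dq dpq.
  have : P i %| (2%:R * s i).
    have -> : 2%:R * s i = (q + s i) + (p - q) - (p - s i) by ring.
    exact: dvdp_sub (dvdp_add dq dpq) dp.
  move/(dvdp_trans (dvdp_exp ci (dvdpp _))).
  by rewrite dvdp_XsubCl /root hornerM -[2%:R]polyC_natr hornerC mulf_eq0
    (negPf two_neq0) (negPf (s0 i ci)).
have Rin (C : {set I}) i : i \in C -> P i %| R C + s i.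
  by move=> iC; have := RP C i; rewrite /sg iC expr1 mulN1r opprK.
have Rout (C : {set I}) i : i \notin C -> P i %| R C - s i.
  by move=> iC; have := RP C i; rewrite /sg (negPf iC) expr0 mul1r.
have out0 (C : {set I}) : C \subset J -> i0 \notin C.
  by move=> sC; apply/negP => /(fintype.subsetP sC); rewrite !inE eqxx.
have {}dv i : P i %| R A - R B.
  case: dv => dv; first exact: Fdv.
  case: (sep i0 (R A) (- R B)) => //; first exact/Rout/out0.
    by rewrite addrC -opprB dvdp_opp Rout ?out0.
  by rewrite opprK Fdv.
apply/setP => i; have [c0|ci] := posnP (c i).
  have noti (C : {set I}) : C \subset J -> (i \in C) = false.
    by move=> sC; apply/negP => /(fintype.subsetP sC); rewrite !inE c0 andbF.
  by rewrite !noti.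
have [iA|iA] := boolP (i \in A); have [iB|iB] := boolP (i \in B) => //.
  case: (sep i (R B) (R A)) => //; rewrite ?Rout ?Rin //.
  by rewrite -opprB dvdp_opp.
by case: (sep i (R A) (R B)) => //; rewrite ?Rout ?Rin.
Qed.
End SquareRoots.
End PolynomialArithmetic.

(** * Stable subspaces of a cyclic module *)

(** The map [phi] identifies [V] with [K[x]/(f)], [T] becoming multiplication
    by [x]. *)
Section CyclicModule.
Variables (K : fieldType) (V : vectType K) (phi : {linear {poly K} -> V}).
Variables (T : 'End(V)) (f : {poly K}).
Hypothesis phi_surj : forall v, exists p, v = phi p.
Hypothesis phi_eq0 : forall p, (phi p == 0) = (f %| p).
Hypothesis phiX : forall p, T (phi p) = phi ('X * p).
Hypothesis f_neq0 : f != 0.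

Lemma eq_phi p q : (phi p == phi q) = (f %| p - q).
Proof. by rewrite -subr_eq0 -linearB phi_eq0. Qed.

Definition mul_span (p : {poly K}) (s : nat) : {vspace V} :=
  <<[tuple phi (p * 'X^l)%R | l < s]>>%VS.

Lemma mul_span_sum p s (k : 'I_s -> K) :
  \sum_(l < s) k l *: [tuple phi (p * 'X^l) | l < s]`_l
  = phi (p * \sum_(l < s) k l *: 'X^l).
Proof.
rewrite mulr_sumr linear_sum; apply: eq_bigr => l _.
by rewrite -scalerAr linearZ (nth_map l) ?size_enum_ord //= nth_ord_enum.
Qed.

Lemma size_sum_Xn s (k : 'I_s -> K) : (size (\sum_(l < s) k l *: 'X^l)%R <= s)%N.
Proof.
apply: (leq_trans (size_sum _ _ _)); apply/bigmax_leqP => l _.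
by rewrite (leq_trans (size_scale_leq _ _)) // size_polyXn.
Qed.

Lemma mem_mul_span p s v :
  v \in mul_span p s <->
  exists2 c : {poly K}, (size c <= s)%N & v = phi (p * c).
Proof.
split=> [/coord_span Ev | [c sc ->]].
  exists (\sum_(l < s) coord [tuple phi (p * 'X^l) | l < s] l v *: 'X^l).
    exact: size_sum_Xn.
  by rewrite {1}Ev mul_span_sum.
rewrite (poly_sum_coef sc) -mul_span_sum; apply: rpred_sum => l _; apply: rpredZ.
by apply/memv_span/mem_nth; rewrite size_tuple.
Qed.

Lemma dim_mul_span p s :
  (forall c : {poly K}, (size c <= s)%N -> f %| p * c -> c = 0) ->
  \dim (mul_span p s) = s.
Proof.
move=> inj; rewrite -[RHS](size_tuple [tuple phi (p * 'X^l) | l < s]).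
apply/eqP; apply: (appP freeP idP) => k.
rewrite mul_span_sum => /eqP; rewrite phi_eq0 => /inj.
rewrite size_sum_Xn => /(_ isT) k0 i.
move/(congr1 (fun q : {poly K} => q`_i)): k0.
rewrite coef0 coef_sum (bigD1 i) //= big1 => [|l li].
  by rewrite addr0 coefZ coefXn eqxx mulr1.
by rewrite coefZ coefXn eq_sym (inj_eq val_inj) (negPf li) mulr0.
Qed.

(** The number of generators is the degree of [f %/ g], so that for a divisor
    [g] of [f] they form a basis of the image of the ideal [(g)]. *)
Definition ideal (g : {poly K}) : {vspace V} := mul_span g (size (f %/ g)).-1.

Lemma mem_ideal g p : g %| f -> (phi p \in ideal g) = (g %| p).
Proof.
move=> gf; apply/idP/idP => [/mem_mul_span[c _ /eqP]|/dvdpP[q ->]].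
  rewrite eq_phi => /(dvdp_trans gf) dv.
  by rewrite -(dvdp_subl _ (_ : g %| g * c)) ?dvdp_mulr.
have fg0 : f %/ g != 0 by rewrite dvdp_div_eq0.
apply/mem_mul_span; exists (q %% (f %/ g)).
  by rewrite -ltnS prednK ?ltn_modp // lt0n size_poly_eq0.
apply/eqP; rewrite eq_phi {1}(divp_eq q (f %/ g)) mulrDl (mulrC g) addrK.
by rewrite -mulrA divpK // dvdp_mull.
Qed.

Lemma dim_ideal g : g %| f -> \dim (ideal g) = (size (f %/ g)).-1.
Proof.
move=> gf; have fg0 : f %/ g != 0 by rewrite dvdp_div_eq0.
have g0 : g != 0 by apply: contraNneq f_neq0 => g0; rewrite g0 dvd0p in gf.
apply: dim_mul_span => c sc; rewrite -{1}(divpK gf) mulrC dvdp_mul2l // => dv.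
apply/eqP; apply: contraLR sc => c0; rewrite -ltnNge.
by rewrite -ltnS prednK ?ltnS ?dvdp_leq // lt0n size_poly_eq0.
Qed.

Lemma stable_mul W p q : stable T W -> phi p \in W -> phi (p * q) \in W.
Proof.
move=> /subvP stW pW; elim/poly_ind: q => [|q c IH].
  by rewrite mulr0 linear0 mem0v.
have -> : p * (q * 'X + c%:P) = 'X * (p * q) + c *: p.
  by rewrite -mul_polyC; ring.
by rewrite linearD linearZ memvD ?memvZ // -phiX stW // memv_img.
Qed.

(** The polynomials mapped into a stable subspace form an ideal; a non-zero
    one of least degree generates it by Euclidean division. *)
Lemma stable_ideal W : stable T W -> exists2 g, g %| f & W = ideal g.
Proof.
move=> stW.
pose P s := `[< exists g : {poly K}, [/\ g != 0, size g = s & phi g \in W] >].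
have exP : exists s, P s.
  exists (size f); apply/asboolP; exists f; split => //.
  have /eqP -> : phi f == 0 by rewrite phi_eq0.
  exact: mem0v.
case: (ex_minnP exP) => s /asboolP[g [g0 sg gW]] smin.
have gdv p : phi p \in W -> g %| p.
  move=> pW; apply: contraT => ndv; have := ltn_modpN0 p g0.
  rewrite sg ltnNge => /negP[]; apply: smin; apply/asboolP.
  exists (p %% g); split => //.
  have -> : p %% g = p - g * (p %/ g) by rewrite {2}(divp_eq p g) mulrC addrAC subrr add0r.
  by rewrite linearB memvB // stable_mul.
have gf : g %| f.
  by apply: gdv; have /eqP -> : phi f == 0; [rewrite phi_eq0 | exact: mem0v].
exists g => //; apply/vspaceP => v; have [p ->] := phi_surj v.
rewrite mem_ideal //; apply/idP/idP => [/gdv //|/dvdpP[q ->]].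
by rewrite mulrC stable_mul.
Qed.

Lemma ideal_stable g : g %| f -> stable T (ideal g).
Proof.
move=> gf; apply/subvP => _ /memv_imgP[v vW ->].
have [p Ev] := phi_surj v; move: vW; rewrite Ev phiX !mem_ideal //.
exact: dvdp_mull.
Qed.

Lemma mem_gen_eigenspace x p :
  (phi p \in gen_eigenspace T x) = (f %| ('X - x%:P) ^+ \dim {:V} * p).
Proof.
rewrite memv_ker -phi_eq0; congr (_ == 0).
elim: (\dim {:V}) => [|k IH]; first by rewrite id_lfunE expr0 mul1r.
rewrite iterS comp_lfunE IH add_lfunE opp_lfunE scale_lfunE id_lfunE phiX.
by rewrite -linearZ -linearB -mul_polyC -mulrBl mulrA exprS.
Qed.

End CyclicModule.

(** * Prescribed stable dimensions as a largest ideal *)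

Section StableDimensions.
Variables (K : fieldType) (V : vectType K) (phi : {linear {poly K} -> V}).
Variables (T : 'End(V)) (I : finType) (a : I -> K) (m d : I -> nat).
Hypothesis a_inj : injective a.
Hypothesis dimV : \dim {:V} = (\sum_i m i)%N.
Hypothesis d_le : forall i, (d i <= m i)%N.
Local Notation f := (split_poly a m).
Hypothesis phi_surj : forall v, exists p, v = phi p.
Hypothesis phi_eq0 : forall p, (phi p == 0) = (f %| p).
Hypothesis phiX : forall p, T (phi p) = phi ('X * p).

Let f_neq0 : f != 0 := split_poly_neq0 a m.
(* The primary part at [a i] is the ideal generated by [cof i]. *)
Let cof i := \prod_(j | j != i) ('X - (a j)%:P) ^+ m j.

Lemma mem_gen_eigenspace_root i p :
  (phi p \in gen_eigenspace T (a i)) = (cof i %| p).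
Proof.
rewrite (mem_gen_eigenspace phi_eq0 phiX) (split_polyD1 a m i).
have cop : coprimep (('X - (a i)%:P) ^+ m i) (cof i) by apply: coprimep_cofactor.
rewrite mulrC Gauss_dvdp // dvdp_mulr; last first.
  by apply: dvdp_exp2l; rewrite dimV (bigD1 i) //= leq_addr.
rewrite andTb Gauss_dvdpr // coprimep_sym; exact: coprimep_cofactor.
Qed.

(** Inside the primary part at [a i] the stable subspaces form a chain with one
    member in each dimension, so the condition at [i] names the largest one
    contained in [X].  The [D]-ideal is the sum of these, and an ideal is
    contained in [X] as soon as its primary parts are. *)
Lemma dim_stable_largest_ideal (X : {vspace V}) :
  let D := split_poly a (fun i => m i - d i)%N in
  (forall i, dim_stable T (X :&: gen_eigenspace T (a i)) (d i)) <->
  (forall q, phi (D * q) \in X) /\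
  (forall g, (forall q, phi (g * q) \in X) -> D %| g).
Proof.
move=> D; pose Z i : {poly K} := 'X - (a i)%:P.
pose c i := cof i * Z i ^+ (m i - d i).
have fE i : f = c i * Z i ^+ d i.
  by rewrite (split_polyD1 a m i) -mulrA -exprD subnK.
have cf i : c i %| f by rewrite (fE i) dvdp_mulr.
have copc i k : coprimep (Z i ^+ k) (cof i) by apply: coprimep_cofactor.
have Z0 i k : Z i ^+ k != 0 by rewrite expf_neq0 // polyXsubC_eq0.
have cof0 i : cof i != 0.
  by apply: contraNneq f_neq0 => c0; rewrite (fE i) /c c0 !mul0r.
have c0 i : c i != 0 by rewrite mulf_neq0.
have ZD i : Z i ^+ (m i - d i) %| D.
  by rewrite /D (split_polyD1 a _ i) dvdp_mull.
have Zcof i j : j != i -> Z j ^+ m j %| cof i.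
  by move=> ji; rewrite /cof (bigD1 j) //= dvdp_mulr.
have cofP i p : (forall j, j != i -> Z j ^+ m j %| p) -> cof i %| p.
  move=> dv; have -> : cof i = split_poly a (fun j => if j == i then 0%N else m j).
    rewrite (split_polyD1 a _ i) eqxx expr0 mulr1.
    by apply: eq_bigr => j /negPf ->.
  apply/dvdp_split_poly => // j; case: eqP => [_|/eqP ji]; last exact: dv.
  by rewrite expr0 dvd1p.
have dimc i : \dim (ideal phi f (c i)) = d i.
  rewrite (dim_ideal phi_eq0 f_neq0 (cf i)) {1}(fE i) mulrC mulpK //.
  by rewrite size_exp_XsubC.
have stI g : g %| f -> stable T (ideal phi f g).
  exact: ideal_stable phi_surj phi_eq0 phiX f_neq0 _.
have memI g p : g %| f -> (phi p \in ideal phi f g) = (g %| p).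
  exact: mem_ideal phi_eq0 f_neq0 _ _.
split=> [dimX | [DX Dmax] i].
  have Wc i : maximal_stable T (X :&: gen_eigenspace T (a i)) (ideal phi f (c i)).
    case: (dimX i) => W [sWX stW maxW] dimW.
    suff -> : ideal phi f (c i) = W by [].
    have [g gf EW] := stable_ideal phi_surj phi_eq0 phiX f_neq0 stW.
    have gW : phi g \in W by rewrite EW memI.
    have := subvP sWX _ gW; rewrite memv_cap => /andP[_].
    rewrite mem_gen_eigenspace_root => /dvdpP[t Eg].
    have tZ : t %| Z i ^+ m i.
      by rewrite -(dvdp_mul2r _ _ (cof0 i)) -Eg mulrC -(split_polyD1 a m i).
    have [k km tk] := dvdp_exp_XsubCP tZ.
    have gk : g %= cof i * Z i ^+ k by rewrite Eg mulrC eqp_mul2l.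
    have km_d : k = (m i - d i)%N.
      have fk : f = cof i * Z i ^+ k * Z i ^+ (m i - k).
        by rewrite (split_polyD1 a m i) -mulrA -exprD subnKC.
      move: dimW; rewrite EW (dim_ideal phi_eq0 f_neq0 gf).
      rewrite (eqp_size (eqp_divr _ gk)) {1}fk mulrC mulpK ?mulf_neq0 //.
      by rewrite size_exp_XsubC /= => <-; rewrite subKn.
    apply/vspaceP => v; have [p ->] := phi_surj v.
    by rewrite EW !memI // /c -km_d (eqp_dvdl _ gk).
  have cX i p : c i %| p -> phi p \in X.
    case: (Wc i) => sub _ _; rewrite -memI // => /(subvP sub).
    by rewrite memv_cap => /andP[].
  split=> [q | g gX].
    have [E EP] := crt_idempotents (P := fun i => Z i ^+ m i)
      (fun i j => @coprimep_XsubC_exp _ _ _ a_inj (m i) (m j) i j).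
    have /eqP -> : phi (D * q) == phi (\sum_i E i * (D * q)).
      rewrite (eq_phi phi_eq0) -mulr_suml -[X in X - _]mul1r -mulrBl dvdp_mulr //.
      apply/dvdp_split_poly => // j.
      rewrite -dvdp_opp opprB (bigD1 j) //= addrAC dvdp_add //.
        by have := EP j j; rewrite eqxx.
      apply: dvdp_sum => i ij.
      by have := EP i j; rewrite (negPf ij) subr0.
    rewrite linear_sum; apply: rpred_sum => i _; apply: (cX i).
    rewrite mulrA dvdp_mulr // dvdp_mul //; apply: cofP => j ji.
    by have := EP i j; rewrite eq_sym (negPf ji) subr0.
  apply/dvdp_split_poly => // i.
  have gcdf : gcdp f (cof i * g) %| f by rewrite dvdp_gcdl.
  case: (Wc i) => _ _ /(_ (ideal phi f (gcdp f (cof i * g)))) sub.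
  have /subvP/(_ (phi (gcdp f (cof i * g)))) : (ideal phi f (gcdp f (cof i * g)) <= ideal phi f (c i))%VS.
    apply: sub; last exact: stI.
    apply/subvP => v; have [p ->] := phi_surj v; rewrite memI // memv_cap => gp.
    rewrite mem_gen_eigenspace_root; apply/andP; split; last first.
      apply: dvdp_trans gp; rewrite dvdp_gcd dvdp_mulIl andbT.
      by rewrite (split_polyD1 a m i) dvdp_mulIl.
    (* Modulo [f] the gcd is a multiple of [g], hence its ideal lies in [X]. *)
    have [[u w] /= uw] := Bezoutp f (cof i * g).
    move: gp; rewrite -(eqp_dvdl _ uw) => /dvdpP[s ->].
    have /eqP -> : phi (s * (u * f + w * (cof i * g)))
       == phi (g * (s * w * cof i)).
      rewrite (eq_phi phi_eq0) (_ : _ - _ = s * u * f) ?dvdp_mull //; ring.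
    exact: gX.
  rewrite !memI // dvdpp => /(_ isT) /dvdp_trans/(_ (dvdp_gcdr _ _)).
  by rewrite dvdp_mul2l.
exists (ideal phi f (c i)) => //; split; first 1 last.
- exact: stI.
- move=> W sWX stW; apply/subvP => v vW; have [p Ev] := phi_surj v.
  have := subvP sWX _ vW; rewrite Ev memI // memv_cap mem_gen_eigenspace_root.
  case/andP => _ cofp; rewrite /c mulrC Gauss_dvdp // cofp andbT.
  apply: dvdp_trans (ZD i) _; apply: Dmax => q.
  have := stable_mul phiX q stW (_ : phi p \in W); rewrite -Ev => /(_ vW).
  by move/(subvP sWX); rewrite memv_cap => /andP[].
apply/subvP => v; have [p ->] := phi_surj v; rewrite memI // memv_cap => cp.
rewrite mem_gen_eigenspace_root (dvdp_trans _ cp) ?dvdp_mulIl // andbT.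
suff /dvdpP[q ->] : D %| p by rewrite mulrC DX.
apply: dvdp_trans cp; apply/dvdp_split_poly => // j.
case: (eqVneq j i) => [->|ji]; first by rewrite dvdp_mulIr.
by rewrite dvdp_mulr // (dvdp_trans _ (Zcof i j ji)) // dvdp_exp2l // leq_subr.
Qed.
End StableDimensions.

(** * Functionals on a quotient of the polynomial ring *)

Section FunctionalDuality.
Variables (K : fieldType) (lam : {scalar {poly K}}) (g F : {poly K}).
Hypothesis F_neq0 : F != 0.
Hypothesis lamF : forall q, lam (g * (F * q)) = 0.
Hypothesis lam_nondeg : forall p, (forall q, lam (g * (p * q)) = 0) -> F %| p.

Lemma functional_mod p q : lam (g * (p * (q %% F))) = lam (g * (p * q)).
Proof.
have -> : g * (p * q) = g * (F * (p * (q %/ F))) + g * (p * (q %% F)).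
  by rewrite {1}(divp_eq q F); ring.
by rewrite linearD lamF add0r.
Qed.

(** The pairing [(p, q) |-> lam (g p q)] is perfect on the finite-dimensional
    space [K[x]/(F)]: its Gram matrix on the monomials has trivial kernel. *)
Lemma functional_repr (L : {scalar {poly K}}) :
  (forall q, L (F * q) = 0) -> exists mu, forall q, lam (g * (mu * q)) = L q.
Proof.
move=> LF; pose s := (size F).-1.
pose H : 'M[K]_s := \matrix_(i, j) lam (g * ('X^i * 'X^j)).
have HE (u : 'rV_s) j : (u *m H) 0 j = lam (g * (rVpoly u * 'X^j)).
  rewrite mxE /rVpoly poly_def mulr_suml mulr_sumr linear_sum.
  apply: eq_bigr => i _; rewrite mxE valK /= -scalerAl -scalerAr linearZ.
  by [].
have polyE q : q %% F = \sum_(i < s) (q %% F)`_i *: 'X^i.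
  apply: poly_sum_coef; rewrite -ltnS prednK ?ltn_modp //.
  by rewrite lt0n size_poly_eq0.
have uH : H \in unitmx.
  rewrite -row_free_unit -kermx_eq0; apply/rowV0P => u /sub_kermxP uH0.
  rewrite -[u]rVpolyK (_ : rVpoly u = 0) ?linear0 //.
  have dv : F %| rVpoly u.
    apply: lam_nondeg => q; rewrite -functional_mod polyE !mulr_sumr linear_sum.
    rewrite big1 // => i _; rewrite -!scalerAr linearZ -HE uH0 mxE.
    exact: mulr0.
  apply/eqP; apply: contraLR dv => nz; rewrite gtNdvdp //.
  by rewrite (leq_ltn_trans (size_poly _ _)) // /s ltn_predL lt0n size_poly_eq0.
pose w : 'rV[K]_s := \row_j L 'X^j.
exists (rVpoly (w *m invmx H)) => q.
have -> : L q = L (q %% F).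
  by rewrite {1}(divp_eq q F) linearD mulrC LF add0r.
rewrite -functional_mod polyE !mulr_sumr !linear_sum; apply: eq_bigr => i _.
by rewrite -!scalerAr !linearZ -HE mulmxKV // mxE.
Qed.
End FunctionalDuality.

(** * Isotropic subspaces and square roots *)

(** Here the cyclic module is [K[x]/(h^2 F)] with [F] of degree [2k + 1]; the
    subspaces to be found contain the ideal [(D)], where [D = h F], and have
    dimension [k + deg h]. *)
Section Isotropic.
Variables (K : fieldType) (V : vectType K) (phi : {linear {poly K} -> V}).
Variables (T : 'End(V)) (b : V -> V -> K) (lam : {scalar {poly K}}).
Variables (h F : {poly K}) (k : nat).
Local Notation D := (h * F).
Local Notation f := (h * (h * F)).
Hypothesis sqrt_closed : forall x : K, exists y, y ^+ 2 = x.
Hypothesis phi_surj : forall v, exists p, v = phi p.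
Hypothesis phi_eq0 : forall p, (phi p == 0) = (f %| p).
Hypothesis phiX : forall p, T (phi p) = phi ('X * p).
Hypothesis b_phi : forall p q, b (phi p) (phi q) = lam (p * q).
Hypothesis lam_nondeg : forall p, (forall q, lam (p * q) = 0) -> f %| p.
Hypothesis h_neq0 : h != 0.
Hypothesis sizeF : size F = k.*2.+2.
Local Notation n := (k + (size h).-1)%N.
Hypothesis dimV : \dim {:V} = n.*2.+1.

Let F_neq0 : F != 0. Proof. by rewrite -size_poly_gt0 sizeF. Qed.
Let D_neq0 : D != 0. Proof. exact: mulf_neq0. Qed.
Let f_neq0 : f != 0. Proof. exact: mulf_neq0. Qed.
Let Df : D %| f. Proof. exact: dvdp_mull. Qed.

Lemma lam_dvd p : f %| p -> lam p = 0.
Proof.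
case/dvdpP => q ->; rewrite mulrC -b_phi.
have /eqP -> : phi f == 0 by rewrite phi_eq0.
by rewrite -[0](linear0 phi) b_phi mul0r linear0.
Qed.

(** Pairing with a complement of [Z] is injective on [X], as [X] already pairs
    to zero with [Z] and the form is non-degenerate. *)
Lemma dim_orthogonal (X Z : {vspace V}) :
  (forall x z, x \in X -> z \in Z -> b x z = 0) ->
  (\dim X + \dim Z <= \dim {:V})%N.
Proof.
move=> orth; pose C := (Z^C)%VS; pose g (v : V) : 'rV_(\dim C) := \row_i b v (vbasis C)`_i.
have blin x : scalar (fun v => b v x).
  have [q ->] := phi_surj x; move=> c u v.
  have [p ->] := phi_surj u; have [p' ->] := phi_surj v.
  by rewrite -linearZ -linearD !b_phi mulrDl -scalerAl linearD linearZ.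
have glin : linear g.
  by move=> c u v; apply/rowP => i; rewrite !mxE blin.
pose gl : {linear V -> 'rV_(\dim C)} := HB.pack g (GRing.isLinear.Build _ _ _ _ g glin).
have bsym x y : b x y = b y x.
  have [p ->] := phi_surj x; have [q ->] := phi_surj y.
  by rewrite !b_phi mulrC.
have inj : (X :&: lker (linfun gl) = 0)%VS.
  apply/eqP; rewrite -subv0; apply/subvP => x.
  rewrite memv_cap memv_ker lfunE memv0 => /andP[xX /eqP gx].
  have [p Ep] := phi_surj x.
  rewrite Ep phi_eq0; apply: lam_nondeg => q; rewrite -b_phi -Ep.
  have: phi q \in (Z + C)%VS by rewrite addv_complf memvf.
  case/memv_addP => z zZ [c cC ->]; rewrite bsym -[z]scale1r blin.
  rewrite mul1r bsym orth // add0r (coord_vbasis cC).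
  elim/big_rec: _ => [|i y _ IH]; last rewrite blin IH addr0 bsym.
    by rewrite -(linear0 phi) Ep b_phi mul0r linear0.
  by have := congr1 (fun M : 'rV_(\dim C) => M 0 i) gx; rewrite !mxE => ->; rewrite mulr0.
have := limg_dim_eq inj => Edim.
have := dimvS (subvf (linfun gl @: X)); rewrite Edim dimvf dim_matrix mul1r /C dimv_compl.
by have := dimvS (subvf Z); lia.
Qed.

(* The functional that normalises isotropy: it kills all products of two
   polynomials of degree less than [k], even after multiplication by ['X]. *)
Let tau (q : {poly K}) := (q %% F)`_k.*2.

Let tau_linear : scalar tau.
Proof. by move=> c p q; rewrite /tau modpD modpZl coefD coefZ. Qed.

Let tauL : {scalar {poly K}} :=
  HB.pack tau (GRing.isLinear.Build _ _ _ _ tau tau_linear).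

Let tau_small (q : {poly K}) : (size q <= k.*2.+1)%N -> tau q = q`_k.*2.
Proof. by move=> sq; rewrite /tau modp_small // sizeF ltnS. Qed.

Let tau_mulF (q : {poly K}) : tau (F * q) = 0.
Proof. by rewrite /tau modp_mulr coef0. Qed.

Let tau_mod (q : {poly K}) : tau (q %% F) = tau q.
Proof. by rewrite /tau modp_id. Qed.

Let tau_nondeg p : (forall q, tau (p * q) = 0) -> F %| p.
Proof.
move=> p0; apply: contraT => ndv.
pose r := p %% F.
have r0 : r != 0 by [].
have sr : (size r < k.*2.+2)%N by rewrite -sizeF ltn_modp.
have sr0 : (0 < size r)%N by rewrite size_poly_gt0.
have := p0 'X^(k.*2.+1 - size r).
have -> : tau (p * 'X^(k.*2.+1 - size r)) = tau (r * 'X^(k.*2.+1 - size r)).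
  by rewrite -tau_mod [in RHS]mulrC -[in RHS]tau_mod modp_mul mulrC.
rewrite tau_small; last by rewrite size_mulXn // subnK // -ltnS.
have top (x : nat) : (0 < x)%N -> (x < k.*2.+2)%N ->
    (k.*2 < k.*2.+1 - x)%N = false /\ (x.-1 = k.*2 - (k.*2.+1 - x))%N.
  by clear; lia.
have [lowF topE] := top _ sr0 sr; rewrite coefMXn lowF => r0'.
by case/negP: r0; rewrite -lead_coef_eq0 lead_coefE topE r0'.
Qed.

Let lam_hhF q : lam (h * h * (F * q)) = 0.
Proof.
have -> : h * h * (F * q) = f * q by ring.
by rewrite lam_dvd // dvdp_mulr.
Qed.

Let lam_hh_nondeg p : (forall q, lam (h * h * (p * q)) = 0) -> F %| p.
Proof.
move=> p0; have : f %| h * (h * p).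
  by apply: lam_nondeg => q; rewrite -(p0 q); congr (lam _); ring.
by rewrite !dvdp_mul2l.
Qed.

(** Both pairings defined by [tau] and by [lam (h^2 _)] are perfect on
    [K[x]/(F)], so they differ by a unit. *)
Lemma coefficient_unit :
  exists2 mu, coprimep mu F & forall q, lam (h * h * (mu * q)) = tau q.
Proof.
have [mu muE] := functional_repr F_neq0 lam_hhF lam_hh_nondeg (L := tauL) tau_mulF.
exists mu => //.
pose g := gcdp mu F.
have gF : g %| F by apply: dvdp_gcdr.
have gmu : g %| mu by apply: dvdp_gcdl.
have Fg0 : F %/ g != 0 by rewrite dvdp_div_eq0.
have : F %| F %/ g.
  apply: tau_nondeg => q; rewrite -[LHS]muE.
  have -> : mu * (F %/ g * q) = F * (mu %/ g * q).
    by rewrite -{1}(divpK gmu) -{2}(divpK gF); ring.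
  exact: lam_hhF.
move/(dvdp_leq Fg0); rewrite size_divp ?gcdp_eq0 ?(negPf F_neq0) ?andbF //.
have g0 : (0 < size g)%N by rewrite size_poly_gt0 gcdp_eq0 (negPf F_neq0) andbF.
have size1 (x y : nat) : (0 < y)%N -> (x.+1 <= x.+1 - y.-1)%N -> y == 1%N.
  by clear; lia.
by rewrite coprimep_def sizeF; apply: size1.
Qed.

Variable mu : {poly K}.
Hypothesis mu_coprime : coprimep mu F.
Hypothesis lam_mu : forall q, lam (h * h * (mu * q)) = tau q.

Let coprime_root p : F %| p ^+ 2 - mu -> coprimep p F.
Proof.
move=> /dvdpP[t Et].
have Emu : p ^+ 2 = mu + t * F by rewrite -Et addrC subrK.
suff : coprimep (p ^+ 2) F by rewrite expr2 coprimepMl => /andP[].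
by rewrite Emu addrC coprimep_sym coprimep_addl_mul coprimep_sym.
Qed.

Let lam_root p q : F %| p ^+ 2 - mu -> lam (h * h * (p * p * q)) = tau q.
Proof.
move=> /dvdpP[t Et]; rewrite -lam_mu.
have -> : h * h * (p * p * q) = h * h * (mu * q) + h * h * (F * (t * q)).
  by have -> : mu = p * p - t * F; [rewrite -Et; ring | ring].
by rewrite linearD lam_hhF addr0.
Qed.

(** [(D)] together with [v, T v, ..., T^(k-1) v] for [v = h p]. *)
Definition root_space (p : {poly K}) : {vspace V} :=
  (ideal phi f D + mul_span phi (h * p) k)%VS.

Lemma mem_root_space p v :
  v \in root_space p <->
  exists e c : {poly K}, (size c <= k)%N /\ v = phi (D * e + h * p * c).
Proof.
split=> [/memv_addP[u uI [w /mem_mul_span[c sc ->] ->]] | [e [c [sc ->]]]].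
  have [q Eq] := phi_surj u; move: uI; rewrite Eq (mem_ideal phi_eq0) //.
  by case/dvdpP=> e ->; exists e, c; rewrite linearD mulrC.
rewrite linearD memv_add //; first by rewrite (mem_ideal phi_eq0) // dvdp_mulr.
by apply/mem_mul_span; exists c.
Qed.

Lemma dim_root_space p : coprimep p F -> \dim (root_space p) = n.
Proof.
move=> cop.
have inj (c : {poly K}) : (size c <= k)%N -> D %| h * p * c -> c = 0.
  move=> sc; rewrite -mulrA dvdp_mul2l // Gauss_dvdpr 1?coprimep_sym // => dv.
  apply/eqP; apply: contraLR dv => c0; rewrite gtNdvdp // sizeF.
  by apply: leq_ltn_trans sc _; rewrite ltnS -addnn leqW ?leq_addr.
rewrite /root_space dimv_disjoint_sum.
  rewrite (dim_ideal phi_eq0) // mulpK // addnC; congr addn.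
  apply: (dim_mul_span phi_eq0) => c sc dv; apply: inj => //.
  exact: dvdp_trans dv.
apply/eqP; rewrite -subv0; apply/subvP => v; rewrite memv_cap => /andP[vI].
case/mem_mul_span => c sc Ev; move: vI; rewrite Ev (mem_ideal phi_eq0) //.
by move/(inj c sc) => ->; rewrite mulr0 linear0 mem0v.
Qed.

(** The last clause says that [(D)] is the largest ideal in [X]; for [D] the
    product of the [(x - alpha i) ^ (m i - d i)] it amounts to the prescribed
    dimensions of stable subspaces. *)
Definition isotropic_over (X : {vspace V}) :=
  [/\ \dim X = n,
      forall v, v \in X -> perp b X v,
      forall v, v \in X -> perp b X (T v)
    & (forall q, phi (D * q) \in X) /\
      (forall g, (forall q, phi (g * q) \in X) -> D %| g)].

(** Products of members of the space are, up to multiples of [f], of the form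
    [h^2 p^2 c c'] with [c c'] of degree at most [2k - 2], where [tau]
    vanishes.  An ideal generated by an element outside [(D)] is not contained
    in the space: multiplying by a suitable power of ['X] raises the degree of
    [c] to exactly [k]. *)
Lemma root_space_isotropic p :
  F %| p ^+ 2 - mu -> isotropic_over (root_space p).
Proof.
move=> rt; have cop := coprime_root rt.
have orth (e c e' c' x : {poly K}) : (size (x * (c * c'))%R <= k.*2)%N ->
    lam (x * (D * e + h * p * c) * (D * e' + h * p * c')) = 0.
  move=> sx.
  have -> : x * (D * e + h * p * c) * (D * e' + h * p * c') =
    h * h * (F * (x * (F * e * e' + p * c * e' + p * c' * e)))
    + h * h * (p * p * (x * (c * c'))) by ring.
  by rewrite linearD lam_hhF add0r lam_root // tau_small ?nth_default // ltnW.
have scc (c c' : {poly K}) : (size c <= k)%N -> (size c' <= k)%N ->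
    (size ('X * (c * c'))%R <= k.*2)%N.
  move=> sc sc'; have [->|c0] := eqVneq c 0; first by rewrite mul0r mulr0 size_poly0.
  have [->|c'0] := eqVneq c' 0; first by rewrite !mulr0 size_poly0.
  rewrite mulrC size_mulX ?mulf_neq0 // size_mul //.
  by rewrite prednK ?addn_gt0 ?size_poly_gt0 ?c0 // -addnn leq_add.
split; first exact: dim_root_space.
- move=> v /mem_root_space[e [c [sc ->]]] w /mem_root_space[e' [c' [sc' ->]]].
  rewrite b_phi -[_ + _ as X in X * _]mul1r orth // mul1r.
  apply: leq_trans (scc c c' sc sc'); have [->|nz] := eqVneq (c * c') 0.
    by rewrite size_poly0.
  by rewrite (mulrC 'X) size_mulX.
- move=> v /mem_root_space[e [c [sc ->]]] w /mem_root_space[e' [c' [sc' ->]]].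
  by rewrite phiX b_phi orth // scc.
split=> [q | g gX].
  by apply/mem_root_space; exists q, 0; rewrite size_poly0 mulr0 addr0.
have gq q : exists2 c : {poly K}, (size c <= k)%N & D %| g * q - h * p * c.
  have /mem_root_space[e [c [sc /eqP]]] := gX q.
  rewrite (eq_phi phi_eq0) => dv; exists c => //.
  rewrite -(dvdp_subl _ (dvdp_mulIl D e)).
  rewrite (_ : _ - _ - _ = g * q - (D * e + h * p * c)); last by ring.
  exact: dvdp_trans Df dv. 
have /dvdpP[g' Eg] : h %| g.
  have [c _] := gq 1; rewrite mulr1 => /(dvdp_trans (dvdp_mulr _ (dvdpp h))).
  by rewrite dvdp_subl // -mulrA dvdp_mulr.
have gq' q : exists2 c : {poly K}, (size c <= k)%N & F %| g' * q - p * c.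
  have [c sc] := gq q; exists c => //; rewrite -(dvdp_mul2l _ _ h_neq0).
  by rewrite (_ : h * (g' * q - p * c) = g * q - h * p * c) // Eg; ring.
rewrite Eg [g' * h]mulrC dvdp_mul2l //.
have [c sc dvc] := gq' 1; rewrite mulr1 in dvc.
have [c0|c0] := eqVneq c 0; first by move: dvc; rewrite c0 mulr0 subr0.
pose s := (k.+1 - size c)%N; have [c2 sc2 dvc2] := gq' 'X^s.
have c_gt0 : (0 < size c)%N by rewrite size_poly_gt0.
have scX : size (c * 'X^s) = k.+1 by rewrite size_mulXn // /s subnK // leqW.
have : F %| c * 'X^s - c2.
  rewrite -(Gauss_dvdpr _ (_ : coprimep F p)) 1?coprimep_sym //.
  have -> : p * (c * 'X^s - c2) = (g' * 'X^s - p * c2) - (g' - p * c) * 'X^s by ring.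
  by rewrite dvdp_sub // dvdp_mulr.
have [/eqP|nz] := eqVneq (c * 'X^s - c2) 0.
  rewrite subr_eq0 => /eqP E; by rewrite -E scX ltnn in sc2.
move/(dvdp_leq nz); rewrite sizeF => /leq_trans/(_ (size_polyD _ _)).
rewrite size_polyN scX (maxn_idPl (leqW sc2)).
by rewrite ltnS ltnNge -addnn leq_addr.
Qed.

(** If the spaces agree then [p = p' c] modulo [F] with [c] of degree at most
    [k]; then [c ^ 2 - 1] is divisible by [F] but of degree at most [2k], so
    it vanishes. *)
Lemma root_space_inj p p' : F %| p ^+ 2 - mu -> F %| p' ^+ 2 - mu ->
  root_space p = root_space p' -> F %| p - p' \/ F %| p + p'.
Proof.
move=> rt rt' E; have cop' := coprime_root rt'.
have [c sc dvc] : exists2 c : {poly K}, (size c <= k.+1)%N & F %| p - p' * c.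
  (* For [k = 0] the spaces carry no information, but then [F] is linear and
     any residue [p / p'] will do. *)
  have [k0|k_gt0] := posnP k.
    have /Bezout_eq1_coprimepP[[u v] /= uv] := cop'.
    exists ((u * p) %% F).
      by rewrite -ltnS (leq_trans (ltn_modpN0 _ F_neq0)) // sizeF k0.
    rewrite (_ : p - _ = F * (p * v + p' * ((u * p) %/ F))) ?dvdp_mulr //.
    have -> : (u * p) %% F = u * p - (u * p) %/ F * F.
      by rewrite {2}(divp_eq (u * p) F) addrC addKr.
    rewrite -{1}[p]mulr1 -uv; ring.
  have : phi (h * p) \in root_space p.
    by apply/mem_root_space; exists 0, 1; rewrite size_poly1 mulr0 add0r mulr1.
  rewrite E => /mem_root_space[e [c [sc /eqP]]].
  rewrite (eq_phi phi_eq0) => /(dvdp_trans Df) dv; exists c; first exact: leqW.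
  rewrite -(dvdp_mul2l _ _ h_neq0).
  have -> : h * (p - p' * c) = h * p - (D * e + h * p' * c) + D * e by ring.
  by apply: dvdp_add dv (dvdp_mulIl _ _).
have dvc2 : F %| c ^+ 2 - 1.
  rewrite -(Gauss_dvdpr _ (_ : coprimep F mu)) 1?coprimep_sym //.
  have -> : mu * (c ^+ 2 - 1) = (p ^+ 2 - mu) - (p' ^+ 2 - mu) * c ^+ 2
    - (p - p' * c) * (p + p' * c) by ring.
  by apply: dvdp_sub; [apply: dvdp_sub => //; apply: dvdp_mulr | apply: dvdp_mulr].
have /eqP : c ^+ 2 - 1 = 0.
  apply/eqP; apply: contraLR dvc2 => nz; rewrite gtNdvdp // sizeF ltnS.
  rewrite (leq_trans (size_polyD _ _)) // size_polyN size_poly1 geq_max andbT.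
  rewrite expr2 (leq_trans (size_polyMleq _ _)) //.
  apply: (@leq_trans (k.+1 + k.+1).-1); last by rewrite addSn addnS addnn.
  by rewrite -!subn1 leq_sub2r // leq_add.
rewrite subr_sqr_1 mulf_eq0 subr_eq0 addr_eq0 => /orP[] /eqP Ec; rewrite Ec in dvc.
  by left; rewrite mulr1 in dvc.
by right; rewrite mulrN1 opprK in dvc.
Qed.

Lemma root_space_sub p p' : F %| p - p' -> (root_space p <= root_space p')%VS.
Proof.
case/dvdpP=> t /(canRL (subrK _)) ->; apply/subvP => v.
case/mem_root_space=> e [c [sc ->]]; apply/mem_root_space.
by exists (e + t * c), c; split=> //; congr (phi _); ring.
Qed.

Lemma root_space_eq p p' :
  F %| p - p' \/ F %| p + p' -> root_space p = root_space p'.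
Proof.
have subN q : (root_space (- q) <= root_space q)%VS.
  apply/subvP => v /mem_root_space[e [c [sc ->]]]; apply/mem_root_space.
  by exists e, (- c); rewrite size_polyN; split=> //; congr (phi _); ring.
case=> dv; apply: subv_anti; apply/andP; split.
- exact: root_space_sub.
- by apply: root_space_sub; rewrite -opprB dvdp_opp.
- by apply: subv_trans (root_space_sub _) (subN p'); rewrite opprK.
- by apply: subv_trans (root_space_sub _) (subN p); rewrite opprK addrC.
Qed.

Section Converse.
Variable X : {vspace V}.
Hypothesis isoX : isotropic_over X.

Let dimX : \dim X = n. Proof. by case: isoX. Qed.
Let DX q : phi (D * q) \in X.
Proof. by case: isoX => _ _ _ [+ _]; apply. Qed.
Let Dmax g : (forall q, phi (g * q) \in X) -> D %| g.
Proof. by case: isoX => _ _ _ [_]; apply. Qed.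
Let lamX p q : phi p \in X -> phi q \in X -> lam (p * q) = 0.
Proof. by case: isoX => _ + _ _ => /[apply]; rewrite -b_phi; apply. Qed.
Let lamTX p q : phi p \in X -> phi q \in X -> lam ('X * p * q) = 0.
Proof. by case: isoX => _ _ + _ => /[apply]; rewrite phiX -b_phi; apply. Qed.

(** Take for [Y] the space of the [v] with [v, T v, ..., T^l v] in [X].  If
    [T^l v] is in [X], then [T^(l+1) v] lies in the orthogonal of [X], where
    [X] has codimension one; so each step costs at most one dimension. *)
Lemma shift_chain l :
  exists2 Y : {vspace V}, (n <= \dim Y + l)%N &
    forall p, phi p \in Y -> forall i, (i <= l)%N -> phi ('X^i * p) \in X.
Proof.
elim: l => [|l [Y dimY YX]].
  by exists X; rewrite ?dimX ?addn0 // => p pX [|//] _; rewrite expr0 mul1r.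
pose S := iter l.+1 (fun g : 'End(V) => T \o g)%VF \1%VF.
have SE p : S (phi p) = phi ('X^(l.+1) * p).
  rewrite /S; elim: (l.+1) => [|i IH]; first by rewrite id_lfunE expr0 mul1r.
  by rewrite iterS comp_lfunE IH phiX mulrA exprS.
pose G : 'End(V) := (\1 - projv X)%VF.
have GX v : (v \in lker G) = (v \in X).
  rewrite memv_ker add_lfunE opp_lfunE id_lfunE subr_eq0.
  by apply/eqP/idP => [->|/projv_id ->]; rewrite ?memv_proj.
exists (Y :&: lker (G \o S)%VF)%VS; last first.
  move=> p; rewrite memv_cap memv_ker comp_lfunE -memv_ker GX SE => /andP[pY pS].
  by move=> i; rewrite leq_eqVlt => /predU1P[-> //|]; apply: YX.
have := limg_ker_dim (G \o S) Y; rewrite limg_comp.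
have : (\dim (G @: (S @: Y)) <= 1)%N.
  pose Z := (S @: Y + X)%VS.
  apply: leq_trans (dimvS (limgS G (addvSl _ X))) _; rewrite -/Z.
  have := limg_ker_dim G Z.
  have : (\dim X <= \dim (Z :&: lker G))%N.
    apply: dimvS; apply/subvP => x xX; rewrite memv_cap GX xX andbT.
    exact: (subvP (addvSr _ _)) xX.
  have : (\dim X + \dim Z <= \dim {:V})%N.
    apply: dim_orthogonal => x z xX /memv_addP[y /memv_imgP[y' y'Y ->] [x' x'X ->]].
    have [q Eq] := phi_surj x; have [p Ep] := phi_surj y'.
    have [p' Ep'] := phi_surj x'; subst x y' x'.
    rewrite SE -linearD b_phi mulrDr linearD (@lamX q p') // addr0.
    have -> : q * ('X^(l.+1) * p) = 'X * ('X^l * p) * q by rewrite exprS; ring.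
    by rewrite lamTX // YX.
  rewrite dimV dimX; lia.
move: dimY; lia.
Qed.

(** The vector [h p0] found by [shift_chain] spans, with its shifts and [(D)],
    a subspace of [X].  Isotropy makes [p0 ^ 2] a multiple [kap] of [mu]
    modulo [F].  If [kap] is non-zero, rescaling [p0] gives a square root of
    [mu], and the dimensions agree.  For [k = 0] every square root gives the
    same space, so any one can be taken. *)
Lemma isotropic_root_space :
  (exists p, F %| p ^+ 2 - mu) ->
  exists2 p, F %| p ^+ 2 - mu & X = root_space p.
Proof.
have fit p : F %| p ^+ 2 - mu ->
    (forall c : {poly K}, (size c <= k)%N -> phi (h * p * c) \in X) ->
    X = root_space p.
  move=> rt pX; apply/esym/eqP; rewrite eqEdim dim_root_space ?coprime_root //.
  rewrite dimX leqnn andbT; apply/subvP => v /mem_root_space[e [c [sc ->]]].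
  by rewrite linearD memvD // pX.
case=> s rts; have [k0|k_gt0] := posnP k.
  exists s => //; apply: fit => // c; rewrite k0 leqn0 size_poly_eq0 => /eqP ->.
  by rewrite mulr0 linear0 mem0v.
have [Y dimY YX] := shift_chain k.-1.
have [p pY ndv] : exists2 p, phi p \in Y & ~~ (D %| p).
  apply: contrapT => none.
  have : (\dim Y <= \dim (ideal phi f D))%N.
    apply: dimvS; apply/subvP => v; have [p ->] := phi_surj v => pY.
    rewrite (mem_ideal phi_eq0) //; apply: contraT => ndv.
    by case: none; exists p.
  rewrite (dim_ideal phi_eq0) // mulpK // leqNgt => /negP[].
  have ltk x y : (0 < k)%N -> (k + x <= y + k.-1)%N -> (x < y)%N by clear; lia.
  exact: ltk k_gt0 dimY.
have /dvdpP[p0 Ep] : h %| p.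
  rewrite -(dvdp_mul2r _ _ D_neq0); apply: lam_nondeg => q.
  rewrite -mulrA lamX ?DX //.
  by have := YX p pY 0%N isT; rewrite expr0 mul1r.
rewrite Ep (mulrC p0) dvdp_mul2l // in ndv.
have p0X i : (i < k)%N -> phi (h * p0 * 'X^i) \in X.
  move=> ik; have -> : h * p0 * 'X^i = 'X^i * p by rewrite Ep; ring.
  by apply: YX => //; rewrite -ltnS prednK.
have p0cX (c : {poly K}) : (size c <= k)%N -> phi (h * p0 * c) \in X.
  move=> sc; rewrite (poly_sum_coef sc).
  rewrite mulr_sumr linear_sum; apply: rpred_sum => i _.
  by rewrite -scalerAr linearZ rpredZ // p0X.
have lam0 i : (i < k.*2)%N -> lam (h * h * (p0 * p0 * 'X^i)) = 0.
  move=> ik; have [lt|ge] := ltnP i k.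
    have -> : h * h * (p0 * p0 * 'X^i) = h * p0 * 'X^i * (h * p0 * 'X^0).
      by rewrite expr0; ring.
    by rewrite lamX // p0X.
  have -> : h * h * (p0 * p0 * 'X^i) =
      'X * (h * p0 * 'X^(i - k)) * (h * p0 * 'X^(k.-1)).
    have splitk (x y : nat) :
        (0 < y)%N -> (y <= x)%N -> x = (1 + (x - y) + y.-1)%N by clear; lia.
    by rewrite {1}(splitk i k) // !exprD expr1; ring.
  rewrite lamTX // p0X //; last by rewrite ltn_predL.
  by rewrite ltn_subLR // addnn.
pose kap := lam (h * h * (p0 * p0 * 'X^(k.*2))).
have lamE q : lam (h * h * (p0 * p0 * q)) = kap * tau q.
  have -> : lam (h * h * (p0 * p0 * q)) = lam (h * h * (p0 * p0 * (q %% F))).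
    exact: esym (functional_mod lam_hhF _ _).
  rewrite {1}(poly_sum_coef (c := q %% F) (s := k.*2.+1)); last first.
    by rewrite -ltnS -sizeF ltn_modp.
  rewrite !mulr_sumr linear_sum big_ord_recr big1 /= => [|i _].
    by rewrite add0r -!scalerAr linearZ; apply: mulrC.
  by rewrite -!scalerAr linearZ /= lam0 ?mulr0.
have dvk : F %| p0 ^+ 2 - kap *: mu.
  apply: lam_hh_nondeg => q.
  have -> : h * h * ((p0 ^+ 2 - kap *: mu) * q) =
     h * h * (p0 * p0 * q) - kap *: (h * h * (mu * q)).
    by rewrite -!mul_polyC; ring.
  by rewrite linearB linearZ /= lamE lam_mu subrr.
have [kap0|kap_neq0] := eqVneq kap 0.
  (* Now [F] divides [p0 ^ 2].  With [g] the gcd of [p0] and [F], the annihilator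
     [G = F / g] of [p0] divides [g], so its degree is at most [k].  Then all
     multiples of [h p0] reduce to those by polynomials of degree less than
     [k], and [X] contains the ideal [(h p0)], which is not inside [(D)]. *)
  exfalso; rewrite kap0 scale0r subr0 in dvk.
  pose g := gcdp p0 F; pose G := F %/ g.
  have EF : F = G * g by rewrite divpK // dvdp_gcdr.
  have Ep0 : p0 = p0 %/ g * g by rewrite divpK // dvdp_gcdl.
  have g0 : g != 0 by rewrite gcdp_eq0 (negPf F_neq0) andbF.
  have G0 : G != 0 by apply: contraNneq F_neq0 => G0; rewrite EF G0 mul0r.
  have cop : coprimep G (p0 %/ g).
    by rewrite coprimep_sym coprimep_div_gcd // F_neq0 orbT.
  have Gg : G %| g.
    move: dvk; rewrite EF {1}Ep0 (_ : _ ^+ 2 = p0 %/ g * (p0 %/ g * g) * g); last by ring.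
    by rewrite dvdp_mul2r // !Gauss_dvdpr.
  have sG : (size G <= k.+1)%N.
    have half (x y : nat) : k.*2.+3 = (x + y)%N -> (x <= y)%N -> (x <= k.+1)%N.
      by clear; lia.
    apply: half (dvdp_leq g0 Gg); rewrite -sizeF EF size_mul // prednK //.
    by rewrite addn_gt0 size_poly_gt0 G0.
  case/negP: ndv; rewrite -(dvdp_mul2l _ _ h_neq0); apply: Dmax => q.
  have -> : h * p0 * q = D * (p0 %/ g * (q %/ G)) + h * p0 * (q %% G).
    rewrite {1}(divp_eq q G) mulrDr; congr (_ + _).
    by rewrite {1}Ep0 [in RHS]EF; ring.
  rewrite linearD memvD // p0cX // -ltnS.
  exact: leq_trans (ltn_modpN0 _ G0) sG.
have [y Ey] := sqrt_closed kap.
have y0 : y != 0 by apply: contraNneq kap_neq0 => y0; rewrite -Ey y0 expr0n.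
have rt : F %| (y^-1 *: p0) ^+ 2 - mu.
  have -> : (y^-1 *: p0) ^+ 2 - mu = kap^-1 *: (p0 ^+ 2 - kap *: mu).
    by rewrite exprZn exprVn Ey scalerBr scalerA mulVf // scale1r.
  by rewrite dvdpZr ?invr_eq0.
exists (y^-1 *: p0) => //; apply: fit => // c sc.
by rewrite -scalerAr -scalerAl linearZ rpredZ // p0cX.
Qed.
End Converse.
End Isotropic.

(** * The count for a cyclic module *)

Lemma card_eq_param (S : finType) (X : Type) (A : {set S}) (G : S -> X)
    (L : set X) :
  (forall x, L x <-> exists2 s, s \in A & x = G s) ->
  {in A &, injective G} -> (L #= `I_(#|A|))%card.
Proof.
move=> LP injG.
pose g (i : 'I_#|A|) := G (enum_val i).
have -> : L = (g @` [set: 'I_#|A|])%classic.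
  apply/seteqP; split=> x /=.
    case/LP => s sA ->; exists (enum_rank_in sA s) => //.
    by rewrite /g enum_rankK_in.
  by case=> i _ <-; apply/LP; exists (enum_val i) => //; apply: enum_valP.
rewrite (card_eqr card_II); apply: inj_card_eq => i j _ _.
by move/(injG _ _ (enum_valP i) (enum_valP j))/enum_val_inj.
Qed.

Section Counting.
Variables (K : fieldType) (V : vectType K) (phi : {linear {poly K} -> V}).
Variables (T : 'End(V)) (b : V -> V -> K) (lam : {scalar {poly K}}).
Variables (r n : nat) (a : 'I_r.+1 -> K) (m d : 'I_r.+1 -> nat).
Local Notation f := (split_poly a m).
Hypothesis two_neq0 : (2%:R : K) != 0.
Hypothesis sqrt_closed : forall x : K, exists y, y ^+ 2 = x.
Hypothesis a_inj : injective a.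
Hypothesis sum_m : (\sum_i m i = n.*2.+1)%N.
Hypothesis d_le : forall i, ((d i).*2 <= m i)%N.
Hypothesis dimV : \dim {:V} = n.*2.+1.
Hypothesis phi_surj : forall v, exists p, v = phi p.
Hypothesis phi_eq0 : forall p, (phi p == 0) = (f %| p).
Hypothesis phiX : forall p, T (phi p) = phi ('X * p).
Hypothesis b_phi : forall p q, b (phi p) (phi q) = lam (p * q).
Hypothesis lam_nondeg : forall p, (forall q, lam (p * q) = 0) -> f %| p.

(** The subspaces are the [root_space]s of the square roots of [mu] modulo [F],
    counted up to sign. *)
Lemma card_LT :
  (LT n b T a d #= `I_(2 ^ #|[set i | ((d i).*2 < m i)%N]|.-1))%card.
Proof.
pose c i := (m i - (d i).*2)%N.
pose h := split_poly a d; pose F := split_poly a c.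
have hFE : h * F = split_poly a (fun i => m i - d i)%N.
  by rewrite split_polyD; apply: eq_bigr => i _; congr (_ ^+ _); have := d_le i; rewrite /c; lia.
have fE : f = h * (h * F).
  rewrite hFE split_polyD; apply: eq_bigr => i _.
  by congr (_ ^+ _); have := d_le i; lia.
pose k := (n - \sum_i d i)%N.
have sums : (\sum_i c i + (\sum_i d i).*2 = n.*2.+1)%N.
  rewrite -sum_m -mul2n big_distrr -big_split; apply: eq_bigr => i _ /=.
  by have := d_le i; rewrite /c; lia.
have sizeF : size F = k.*2.+2.
  rewrite size_split_poly /k; move: sums.
  by move: (\sum_i c i)%N (\sum_i d i)%N => x y; lia.
have kn : (k + (size h).-1 = n)%N.
  rewrite size_split_poly /k /=; move: sums.
  by move: (\sum_i c i)%N (\sum_i d i)%N => x y; lia.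
(* [F] has odd degree, so one of its roots has positive multiplicity. *)
have [i0 ci0] : exists i0, (0 < c i0)%N.
  apply/existsP; apply: contraT; rewrite negb_exists => /forallP c0.
  have : (\sum_i c i = 0)%N.
    by apply: big1 => i _; have := c0 i; rewrite lt0n negbK => /eqP.
  lia.
have JE : [set i | ((d i).*2 < m i)%N] = [set i | (0 < c i)%N].
  by apply/setP => i; rewrite !inE subn_gt0.
have h0 : h != 0 := split_poly_neq0 a d.
have F0 : F != 0 := split_poly_neq0 a c.
have phi_eq0' p : (phi p == 0) = (h * (h * F) %| p) by rewrite -fE.
have lam_nondeg' p : (forall q, lam (p * q) = 0) -> h * (h * F) %| p.
  by rewrite -fE; apply: lam_nondeg.
have dimV' : \dim {:V} = (k + (size h).-1).*2.+1 by rewrite kn.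
have LTE X : LT n b T a d X <-> isotropic_over phi T b h F k X.
  rewrite /isotropic_over kn hFE.
  have dm i : (d i <= m i)%N by have := d_le i; lia.
  have E := dim_stable_largest_ideal a_inj (etrans dimV (esym sum_m)) dm phi_surj phi_eq0 phiX X.
  by split=> [] [? ? ? ?]; split => //; apply/E.
have [mu mucop muE] := coefficient_unit phi_eq0' b_phi lam_nondeg' h0 sizeF.
have mu0 i : (0 < c i)%N -> mu.[a i] != 0.
  move=> ci; rewrite -[_ == 0]/(root mu (a i)) -coprimep_XsubC.
  rewrite -(coprimep_pexpr _ _ ci); apply: coprimep_dvdl mucop.
  by rewrite /F (split_polyD1 a c i) dvdp_mull.
have [R [Rroot Rall Rinj]] := sqrt_mod_signs two_neq0 sqrt_closed a_inj mu0 ci0.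
pose G A := root_space phi h F k (R A).
have -> : (2 ^ #|[set i | ((d i).*2 < m i)%N]|.-1)%N
    = #|powerset ([set i | (0 < c i)%N] :\ i0)|.
  by rewrite card_powerset JE (cardsD1 i0 [set i | _]) inE ci0.
apply: (card_eq_param (G := G)) => [X | A B].
  rewrite LTE; split=> [iso | [A _ ->]]; last first.
    exact: (root_space_isotropic phi_surj phi_eq0' phiX b_phi h0 sizeF mucop muE (Rroot A)).
  have exrt : exists p, F %| p ^+ 2 - mu by exists (R finset.set0).
  have [p rt ->] := isotropic_root_space sqrt_closed phi_surj phi_eq0' phiX
    b_phi lam_nondeg' h0 sizeF dimV' mucop muE iso exrt.
  have [A AJ pA] := Rall p rt.
  exists A; first by rewrite powersetE.
  exact: (root_space_eq phi_surj phi_eq0' h0 sizeF pA).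
rewrite /= !powersetE => AJ BJ E; apply: Rinj => //.
exact: (root_space_inj phi_surj phi_eq0' h0 sizeF mucop (Rroot A) (Rroot B) E).
Qed.
End Counting.

(** * A cyclic vector for an operator with one-dimensional eigenspaces *)

Section CyclicVector.
Variables (K : fieldType) (s : nat) (M : 'M[K]_s.+1).
Variables (I : finType) (a : I -> K) (m : I -> nat).
Hypothesis a_inj : injective a.
Hypothesis m_gt0 : forall i, (0 < m i)%N.
Hypothesis charM : char_poly M = split_poly a m.
Hypothesis rankM : forall i, \rank (M - (a i)%:M) = s.
Local Notation f := (split_poly a m).

Lemma sum_multiplicities : (\sum_i m i = s.+1)%N.
Proof. by have := size_char_poly M; rewrite charM size_split_poly => -[]. Qed.

(** Each linear factor lowers the rank by at most one.  Hence no polynomial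
    obtained from [f] by removing a linear factor annihilates [M]. *)
Lemma rank_split_poly (c : I -> nat) :
  (s.+1 <= \rank (horner_mx M (split_poly a c)) + \sum_i c i)%N.
Proof.
pose P (p : {poly K}) k := (s.+1 <= \rank (horner_mx M p) + k)%N.
have Pmul p q k l : P p k -> P q l -> P (p * q) (k + l)%N.
  rewrite /P rmorphM => Pp Pq.
  have := mxrank_mul_min (horner_mx M p) (horner_mx M q).
  rewrite -[_ *m _]/(_ * _); move: Pp Pq.
  move: (\rank _) (\rank _) (\rank _) => x y z; lia.
have P1 : P 1 0%N by rewrite /P rmorph1 mxrank1 addn0.
have PX i k : P (('X - (a i)%:P) ^+ k) k.
  elim: k => [|k IH]; first by rewrite expr0.
  rewrite exprS -add1n; apply: Pmul => //.
  by rewrite /P rmorphB /= horner_mx_X horner_mx_C rankM addn1.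
by rewrite -/(P _ _) /split_poly; elim/big_rec2: _ => [//|i k p _ IH]; apply: Pmul.
Qed.

Lemma horner_mx_dvd0 p : f %| p -> horner_mx M p = 0.
Proof. by case/dvdpP=> q ->; rewrite rmorphM /= -charM Cayley_Hamilton mulr0. Qed.

(** For each [i] some vector is not annihilated by [f / ('X - a i)].  The sum
    of the primary components of these vectors at their respective roots has
    this property for all [i] at once, so its annihilator is [(f)]. *)
Lemma cyclic_vector :
  exists v : 'rV_s.+1, forall p, (v *m horner_mx M p == 0) = (f %| p).
Proof.
pose Z i : {poly K} := 'X - (a i)%:P.
pose c i j := (m j - (j == i))%N.
pose fZ i := split_poly a (c i).
have cof i : exists g : {poly K}, f = g * Z i ^+ m i /\ fZ i = g * Z i ^+ (m i).-1.
  exists (\prod_(j | j != i) Z j ^+ m j); split; first exact: split_polyD1.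
  rewrite /fZ (split_polyD1 a _ i) /c eqxx subn1; congr (_ * _).
  by apply: eq_bigr => j /negPf ->; rewrite subn0.
have fE i : f = fZ i * Z i.
  by have [g [-> ->]] := cof i; rewrite -mulrA -exprSr prednK.
have [v vP] : exists v : I -> 'rV_s.+1, forall i, v i *m horner_mx M (fZ i) != 0.
  apply: (@fin_all_exists _ _ (fun i v => v *m horner_mx M (fZ i) != 0)) => i.
  have : horner_mx M (fZ i) != 0.
    rewrite -mxrank_eq0 -lt0n; have := rank_split_poly (c i).
    have : (\sum_j c i j + 1 = s.+1)%N.
      rewrite -sum_multiplicities (bigD1 i) //= [in RHS](bigD1 i) //= /c eqxx.
      rewrite addnAC subnK //; congr addn.
      by apply: eq_bigr => j /negPf ->; rewrite subn0.
    rewrite -/(fZ i); move: (\sum_j c i j)%N (\rank _) => x y; lia.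
  case/matrix0Pn => k [l kl]; exists (delta_mx 0 k); rewrite -rowE.
  by apply: contraNneq kl => /rowP/(_ l); rewrite !mxE => ->.
have [E EP] := crt_idempotents (P := fun i => Z i ^+ m i)
  (fun i j => @coprimep_XsubC_exp _ _ _ a_inj (m i) (m j) i j).
pose v0 := \sum_i v i *m horner_mx M (E i).
have v0fZ l : v0 *m horner_mx M (fZ l) != 0.
  suff -> : v0 *m horner_mx M (fZ l) = v l *m horner_mx M (fZ l) by [].
  have fEl i : f %| (E i - (i == l)%:R) * fZ l.
    have [g [-> ->]] := cof l; rewrite [X in _ %| X]mulrC.
    exact: dvdp_mul (dvdp_mulIl _ _) (EP i l).
  have termE i : v i *m horner_mx M (E i) *m horner_mx M (fZ l)
      = (i == l)%:R *: (v i *m horner_mx M (fZ l)).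
    rewrite -mulmxA -[horner_mx M (E i) *m _]/(_ * _) -rmorphM.
    have -> : E i * fZ l = (E i - (i == l)%:R) * fZ l + (i == l)%:R *: fZ l.
      by rewrite -mul_polyC polyC_natr; ring.
    by rewrite rmorphD /= horner_mx_dvd0 // add0r linearZ /= -scalemxAr.
  rewrite /v0 mulmx_suml (bigD1 l) //= termE eqxx scale1r big1 ?addr0 // => i.
  by rewrite termE => /negPf ->; rewrite scale0r.
exists v0 => p; apply/eqP/idP => [vp0|]; last by move/horner_mx_dvd0 ->; rewrite mulmx0.
apply/dvdp_split_poly => // i.
(* If the power of ['X - a i] in [p] were not full, a combination of [p] and
   [f] would divide [f / ('X - a i)] and annihilate [v0]. *)
have [k km gk] : exists2 k, (k <= m i)%N & gcdp p (Z i ^+ m i) %= Z i ^+ k.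
  by apply/dvdp_exp_XsubCP; apply: dvdp_gcdr.
move: km; rewrite leq_eqVlt => /predU1P[km|km].
  by rewrite -[X in _ ^+ X]km -(eqp_dvdl _ gk) dvdp_gcdl.
have [[u w] /= uw] := Bezoutp p (Z i ^+ m i).
have [g [fg fZg]] := cof i.
case/negP: (v0fZ i).
have /dvdpP[t Et] : u * p + w * Z i ^+ m i %| Z i ^+ (m i).-1.
  rewrite (eqp_dvdl _ uw) (eqp_dvdl _ gk) dvdp_exp2l //.
  by rewrite -ltnS prednK.
have -> : fZ i = p * (t * u * g) + f * (t * w) by rewrite fZg fg Et; ring.
rewrite rmorphD rmorphM /= mulmxDr mulmxA vp0 mul0mx add0r.
by rewrite horner_mx_dvd0 ?dvdp_mulIl // mulmx0.
Qed.

(** The iterates of [v] under [M] are independent, hence a basis. *)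
Lemma cyclic_vector_surj (v : 'rV_s.+1) :
  (forall p, (v *m horner_mx M p == 0) = (f %| p)) ->
  forall u, exists p, u = v *m horner_mx M p.
Proof.
move=> vP; pose P : 'M[K]_s.+1 := \matrix_i (v *m M ^+ i).
have PE u : u *m P = v *m horner_mx M (rVpoly u).
  rewrite mulmx_sum_row /rVpoly poly_def linear_sum mulmx_sumr.
  apply: eq_bigr => i _; rewrite valK /= linearZ /= rmorphXn /= horner_mx_X.
  by rewrite rowK scalemxAr.
have uP : P \in unitmx.
  rewrite -row_free_unit -kermx_eq0; apply/rowV0P => u /sub_kermxP.
  rewrite PE => /eqP; rewrite vP => dv; rewrite -[u]rVpolyK.
  suff -> : rVpoly u = 0 by rewrite linear0.
  apply/eqP; apply: contraLR dv => nz; rewrite gtNdvdp //.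
  by rewrite size_split_poly sum_multiplicities ltnS size_poly.
by move=> u; exists (rVpoly (u *m invmx P)); rewrite -PE mulmxKV.
Qed.
End CyclicVector.

(** * The count in coordinates *)

(** Self-adjointness, [A M^T = M A], turns the form into a linear functional of
    the product of the two polynomials in [M]. *)
Lemma card_LT_matrix (K : fieldType) (n r : nat) (A M : 'M[K]_(n.*2.+1))
    (a : 'I_r.+1 -> K) (m d : 'I_r.+1 -> nat) :
  (2%:R : K) != 0 -> (forall x : K, exists y, y ^+ 2 = x) ->
  injective a -> (forall i, (0 < m i)%N) -> (forall i, ((d i).*2 <= m i)%N) ->
  char_poly M = split_poly a m ->
  (forall i, \rank (M - (a i)%:M) = n.*2) ->
  A \in unitmx -> A *m M^T = M *m A ->
  (LT n (fun x y : 'rV_(n.*2.+1) => (x *m A *m y^T) 0 0) (linfun (mulmxr M)) a d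
    #= `I_(2 ^ #|[set i | ((d i).*2 < m i)%N]|.-1))%card.
Proof.
move=> two0 sqrtK a_inj m_gt0 d_le charM rankM unitA adjM.
have [v vP] := cyclic_vector a_inj m_gt0 charM rankM.
have v_surj := cyclic_vector_surj charM vP.
pose phi : {linear {poly K} -> 'rV[K]_(n.*2.+1)} := mulmx v \o horner_mx M.
pose lamf (p : {poly K}) := (v *m horner_mx M p *m A *m v^T) 0 0.
have lam_lin : scalar lamf.
  move=> c p q; rewrite /lamf linearD linearZ /= mulmxDr !mulmxDl mxE.
  by rewrite -scalemxAr -!scalemxAl [X in X + _]mxE.
pose lam : {scalar {poly K}} :=
  HB.pack lamf (GRing.isLinear.Build _ _ _ _ lamf lam_lin).
have adj q : A *m (horner_mx M q)^T = horner_mx M q *m A.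
  elim/poly_ind: q => [|q c IH].
    by rewrite rmorph0 trmx0 mulmx0 mul0mx.
  have -> : q * 'X + c%:P = 'X * q + c%:P by rewrite mulrC.
  rewrite rmorphD rmorphM /= horner_mx_X horner_mx_C.
  rewrite linearD /= mulmxDr mulmxDl trmx_mul tr_scalar_mx scalar_mxC.
  rewrite mulmxA IH -mulmxA adjM mulmxA; congr (_ *m _ + _).
  exact: comm_horner_mx.
have b_phi p q : (phi p *m A *m (phi q)^T) 0 0 = lam (p * q).
  rewrite /= /lamf trmx_mul mulmxA -(mulmxA _ A) adj rmorphM.
  by rewrite -[_ * _]/(_ *m _) !mulmxA.
apply: (@card_LT _ _ phi _ _ lam) => //.
- by rewrite (sum_multiplicities charM).
- by rewrite dimvf dim_matrix mul1r.
- by move=> p; rewrite lfunE /= mulrC rmorphM /= horner_mx_X mulmxA.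
move=> p p0; rewrite -vP.
have : v *m horner_mx M p *m A == 0.
  apply/eqP/rowP => i; have [q Eq] := v_surj (delta_mx 0 i).
  have := p0 q; rewrite -b_phi /= -Eq => E.
  rewrite [RHS]mxE -[RHS]E trmx_delta [RHS]mxE (bigD1 i) //= big1 => [|k ki].
    by rewrite [delta_mx _ _ _ _]mxE !eqxx mulr1 addr0.
  by rewrite [delta_mx _ _ _ _]mxE (negPf ki) mulr0.
by move=> /eqP E; rewrite -[_ *m _](mulmxK unitA) E mul0mx.
Qed.

(** * The pencil over the base field *)

(** In characteristic different from 2 the polynomial ['X^2 - x] is separable
    for non-zero [x]. *)
Lemma separable_closure_sqrt (k ks : fieldType) (iota : {rmorphism k -> ks}) :
  separable_closure iota -> (2%:R : ks) != 0 ->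
  forall x : ks, exists y, y ^+ 2 = x.
Proof.
move=> [_ clos] two0 x; have [->|x0] := eqVneq x 0.
  by exists 0; rewrite expr0n.
have [] := clos ('X^2 - x%:P).
- rewrite separable_poly.unlock derivB derivXn derivC subr0 expr1 -scaler_nat.
  rewrite coprimepZr // coprimepX /root !hornerE expr0n /= sub0r oppr_eq0 //.
- by rewrite size_XnsubC.
by move=> y; rewrite /root !hornerE subr_eq0 => /eqP Ey; exists y.
Qed.

Section Gram.
Variables (k : fieldType) (U : vectType k) (N : nat) (e : N.-tuple U).
Hypothesis e_basis : basis_of fullv e.

Lemma polarC (Q : U -> k) x y : polar Q x y = polar Q y x.
Proof. by rewrite /polar (addrC x) -!addrA (addrC (- Q x)). Qed.

Lemma polar_sum (Q : U -> k) x (c : 'I_N -> k) : quadratic_form Q ->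
  polar Q x (\sum_i c i *: e`_i) = \sum_i c i * polar Q x e`_i.
Proof.
move=> [_ Qlin]; elim/big_rec2: _ => [|i y1 y2 _ <-]; last exact: Qlin.
have := Qlin 1 x 0 0; rewrite scaler0 addr0 mul1r.
by move/(congr1 (fun z => z - polar Q x 0)); rewrite addrK subrr.
Qed.

Lemma gram_unit (Q : U -> k) :
  quadratic_form Q -> nondegenerate_form (polar Q) ->
  gram e (polar Q) \in unitmx.
Proof.
move=> quad nondeg; rewrite -row_free_unit -kermx_eq0.
apply/rowV0P => u /sub_kermxP uG.
pose x := \sum_i u 0 i *: e`_i.
have x0 : x = 0.
  apply: nondeg => w; rewrite (coord_basis e_basis (memvf w)) polar_sum //.
  apply: big1 => j _; rewrite polarC polar_sum //.
  have := congr1 (fun B : 'rV_N => B 0 j) uG; rewrite !mxE => E.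
  rewrite -[RHS](mulr0 (coord e j w)) -[in RHS]E; congr (_ * _).
  by apply: eq_bigr => i _; rewrite mxE polarC.
apply/rowP => i; rewrite mxE.
rewrite -(coord_sum_free (u 0) i (basis_free e_basis)) -/x x0.
exact: linear0.
Qed.

(** [M] has the coordinates of the images of the basis as rows, so it acts on
    row vectors from the right. *)
Lemma gram_adjoint (Q1 Q2 : U -> k) (T : 'End(U)) :
  quadratic_form Q1 ->
  (forall v w, polar Q2 v w = polar Q1 v (T w)) ->
  let M := \matrix_(i, j) coord e j (T e`_i) in
  gram e (polar Q2) = M *m gram e (polar Q1) /\
  gram e (polar Q1) *m M^T = M *m gram e (polar Q1).
Proof.
move=> quad adj M.
have E (i j : 'I_N) : polar Q2 e`_i e`_j = \sum_l M j l * polar Q1 e`_i e`_l.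
  rewrite adj [in LHS](coord_basis e_basis (memvf (T e`_j))) polar_sum //.
  by apply: eq_bigr => l _; rewrite mxE.
have G2 : gram e (polar Q2) = M *m gram e (polar Q1).
  apply/matrixP => i j; rewrite [LHS]mxE polarC E [RHS]mxE.
  by apply: eq_bigr => l _; rewrite [gram _ _ _ _]mxE (polarC _ e`_l).
split=> //; rewrite -G2; apply/matrixP => i j; rewrite [LHS]mxE [RHS]mxE E.
by apply: eq_bigr => l _; rewrite [gram _ _ _ _]mxE [M^T _ _]mxE mulrC.
Qed.
End Gram.

Lemma pencil_poly_char (F : fieldType) (n N : nat) (A M : 'M[F]_N) :
  pencil_poly n A (M *m A) = ((-1) ^+ n * \det A) *: char_poly M.
Proof.
rewrite /pencil_poly map_mxM -mul_scalar_mx -mulmxBl det_mulmx det_map_mx.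
by rewrite -[\det (_ - _)]/(char_poly M) mulrC mul_polyC scalerA.
Qed.

Theorem theorem1p2
  (k : fieldType) (char_k : 2%N \notin [pchar k])
  (ks : fieldType) (iota : {rmorphism k -> ks})
  (ks_sep : separable_closure iota)
  (kbar : closedFieldType) (j : {rmorphism ks -> kbar})
  (kbar_alg : algebraic_closure (j \o iota : {rmorphism k -> kbar}))
  (n : nat) (n_ge1 : (1 <= n)%N)
  (U : vectType k) (dimU : \dim {:U} = n.*2.+1)
  (Q1 Q2 : U -> k)
  (quad1 : quadratic_form Q1) (quad2 : quadratic_form Q2)
  (nondeg1 : nondegenerate_form (polar Q1))
  (e : (n.*2.+1).-tuple U) (e_basis : basis_of fullv e)
  (f_monic : pencil_poly n (gram e (polar Q1)) (gram e (polar Q2)) \is monic)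
  (T : 'End(U))
  (T_adj : forall v w : U, polar Q2 v w = polar Q1 v (T w))
  (regular : regular_pencil
     (map_mx (j \o iota) (gram e (polar Q1)))
     (map_mx (j \o iota) (gram e (polar Q2))))
  (r : nat) (alpha : 'I_r.+1 -> ks) (m : 'I_r.+1 -> nat)
  (alpha_inj : injective alpha)
  (m_gt0 : forall i, (0 < m i)%N)
  (f_split :
     map_poly iota (pencil_poly n (gram e (polar Q1)) (gram e (polar Q2)))
     = \prod_(i < r.+1) ('X - (alpha i)%:P) ^+ m i)
  (d : 'I_r.+1 -> nat)
  (d_le : forall i, ((d i).*2 <= m i)%N) :
  exists2 N : nat,
    (LT n (ext_form iota e (polar Q1)) (ext_end iota e T) alpha d #= `I_N)%card
  & N%:R = 2%:R ^+ r / 2%:R ^+ #|[set i | (d i).*2 == m i]| :> rat.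
Proof.
have two_k : (2%:R : k) != 0 by move: char_k; rewrite inE.
have two0 : (2%:R : ks) != 0 by rewrite -(rmorph_nat iota) fmorph_eq0.
have sqrtK := separable_closure_sqrt ks_sep two0.
pose M0 : 'M[k]_(n.*2.+1) := \matrix_(i, l) coord e l (T e`_i).
have [G2 adjM0] := gram_adjoint e_basis quad1 T_adj.
rewrite -/M0 in G2 adjM0.
have unitG := gram_unit e_basis quad1 nondeg1.
set G := gram e (polar Q1) in G2 adjM0 unitG regular f_monic f_split *.
rewrite G2 pencil_poly_char in regular f_monic f_split.
(* Monicity fixes the determinant of [Q1]; the pencil polynomial is then the
   characteristic polynomial of [T]. *)
have detG : (-1) ^+ n * \det G = 1.
  move/monicP: f_monic; rewrite lead_coefZ (monicP (char_poly_monic _)).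
  by rewrite mulr1.
rewrite detG scale1r in f_split.
pose A := map_mx iota G; pose M := map_mx iota M0.
have charM : char_poly M = split_poly alpha m by rewrite -map_char_poly f_split.
have unitA : A \in unitmx by rewrite map_unitmx.
have adjM : A *m M^T = M *m A by rewrite matrix.map_trmx -!map_mxM adjM0.
(* The member of the pencil with parameter [alpha i] is singular, hence a
   simple cone, over the algebraic closure; ranks do not depend on the field. *)
have rankM i : \rank (M - (alpha i)%:M) = n.*2.
  pose B := (alpha i)%:M *m A - M *m A.
  have rankB : \rank B = \rank (M - (alpha i)%:M).
    by rewrite /B -mulmxBl mxrankMfree ?row_free_unit // -mxrank_opp opprB.
  have detB : \det B = 0.
    have : root (char_poly M) (alpha i).
      by rewrite charM -dvdp_XsubCl (split_polyD1 _ _ i) dvdp_mull // dvdp_exp.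
    rewrite -eigenvalue_root_char => /eigenvalueP[u uM u0].
    apply/eqP; rewrite /B -mulmxBl det_mulmx mulf_eq0; apply/orP; left.
    apply/det0P; exists u => //.
    by rewrite mulmxBr mul_mx_scalar uM subrr.
  have EB : map_mx j B = j (alpha i) *: map_mx (j \o iota) G
      + (-1) *: map_mx (j \o iota) (M0 *m G).
    rewrite /B mul_scalar_mx -map_mxM map_mxB map_mxZ scaleN1r.
    by congr (_ *: _ - _); apply/matrixP => x y; rewrite !mxE.
  have := regular (j (alpha i)) (-1); rewrite -EB det_map_mx detB rmorph0.
  rewrite xpair_eqE oppr_eq0 oner_eq0 andbF => /(_ isT erefl).
  rewrite /simple_cone mxrank_ker mxrank_map rankB.
  have := rank_leq_row (M - (alpha i)%:M); move: (\rank _) => x; lia.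
have cardL := card_LT_matrix two0 sqrtK alpha_inj m_gt0 d_le charM rankM unitA adjM.
exists (2 ^ #|[set i | ((d i).*2 < m i)%N]|.-1)%N.
  have -> : ext_end iota e T = linfun (mulmxr M).
    by congr (linfun (mulmxr _)); apply/matrixP => x y; rewrite !mxE.
  exact: cardL.
pose S := [set i | (d i).*2 == m i].
have cardS : (#|[set i | ((d i).*2 < m i)%N]| + #|S| = r.+1)%N.
  rewrite -[RHS]card_ord -(cardsC S) addnC; congr (_ + _)%N.
  by apply: eq_card => i; rewrite !inE ltn_neqAle d_le andbT.
(* The multiplicities have an odd sum, so they are not all even. *)
have J0 : (0 < #|[set i | ((d i).*2 < m i)%N]|)%N.
  rewrite lt0n; apply/negP => /eqP J0.
  have : (\sum_i m i = (\sum_i d i).*2)%N.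
    rewrite -mul2n big_distrr; apply: eq_bigr => i _ /=.
    move/eqP: J0; rewrite cards_eq0 => /eqP/setP/(_ i).
    by rewrite !inE mul2n ltn_neqAle d_le andbT => /negbFE/eqP.
  by rewrite (sum_multiplicities charM) => /(congr1 odd); rewrite /= !odd_double.
rewrite -/S natrX; apply: (canRL (mulfK _)); first by rewrite expf_neq0.
by rewrite -exprD; congr (_ ^+ _); move: cardS J0; lia.
Qed.
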